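(* Let $r\geq 1$ be an integer, put $d=2r-1$, and let $\beta>0$ and $0<c<1$. Define polynomials $\mathcal{M}_n(x;\beta,c,d)$, $n\ge 0$, by the generating function $$\sum_{n=0}^{\infty}\mathcal{M}_n(x;\beta,c,d)\frac{z^n}{n!}=\exp\Big(z+\frac{(-1)^r}{1-c}z^r\Big)\,{}_1F_1\left(\begin{matrix}-x\\ \beta\end{matrix};-z\right).$$ For $i\in\{0,1,\dots,d-1\}$ and integers $k\ge 0$ put $$w_{i\,k}=\frac{(-1)^i(1-c)^{\frac{\beta+i}{r}}}{r\,\Gamma(\beta)\sqrt{i!(\beta)_i}}\sum_{s=0}^{r-1}\frac{(-k)_s\,(1-c)^{s/r}}{s!(\beta)_s}\Gamma\Big(\frac{\beta+i+s}{r}\Big)\;{}_{r+2}F_{2r}\left(\begin{matrix}1,\ \Delta(r,-k+s),\ \frac{\beta+s+i}{r}\\ \Delta(r,\beta+s),\ \Delta(r,s+1)\end{matrix};\frac{1-c}{r^r}\right),$$ and define linear functionals on polynomials by $$\mathcal{L}_i(f)=\sum_{k=0}^{\infty}w_{i\,k}\frac{(\beta)_k}{k!}f(k).$$ Then $\{\mathcal{M}_n(x;\beta,c,d)\}_{n\ge0}$ is a $d$-orthogonal polynomial set with respect to the functional vector $(\mathcal{L}_0,\mathcal{L}_1,\dots,\mathcal{L}_{d-1})$.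
   Context: $(a)_n=a(a+1)\cdots(a+n-1)$, $(a)_0=1$, is the Pochhammer symbol, and ${}_pF_q\left(\begin{matrix}a_1,\dots,a_p\\ b_1,\dots,b_q\end{matrix};x\right)=\sum_{m\ge0}\frac{(a_1)_m\cdots(a_p)_m}{(b_1)_m\cdots(b_q)_m}\frac{x^m}{m!}$. For an integer $r\ge1$ and a number $m$, $\Delta(r,m)$ denotes the list of $r$ parameters $\frac{m}{r},\frac{m+1}{r},\dots,\frac{m+r-1}{r}$. A polynomial set is a sequence $\{Q_n\}_{n\ge0}$ of complex polynomials with $\deg Q_n=n$ for all $n$. For a positive integer $d$, a polynomial set $\{Q_n\}_{n\ge0}$ is a $d$-orthogonal polynomial set with respect to a vector $(\mathcal{L}_0,\dots,\mathcal{L}_{d-1})$ of linear functionals on the space of polynomials if for each $i\in\{0,\dots,d-1\}$: $\mathcal{L}_i(Q_mQ_n)=0$ whenever $n\ge md+i+1$, and $\mathcal{L}_i(Q_nQ_{nd+i})\neq0$ for all $n\ge0$. *)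

(* Defs.v *)
From Stdlib Require Import Reals List Arith Factorial.
From Coquelicot Require Import Coquelicot.
Open Scope R_scope.

Fixpoint poch (a : R) (n : nat) : R :=
  match n with
  | O => 1
  | S m => poch a m * (a + INR m)
  end.

Definition hyp_term (As Bs : list R) (x : R) (m : nat) : R :=
  fold_right Rmult 1 (map (fun a => poch a m) As)
  / fold_right Rmult 1 (map (fun b => poch b m) Bs)
  * x ^ m / INR (fact m).

Definition pFq (As Bs : list R) (x : R) : R := Series (hyp_term As Bs x).

Definition Delta (r : nat) (m : R) : list R :=
  map (fun j => (m + INR j) / INR r) (seq 0 r).

Definition Gamma (x : R) : R :=
  RInt_gen (fun t => Rpower t (x - 1) * exp (- t)) (at_right 0) (Rbar_locally p_infty).

Definition is_poly_deg (f : R -> R) (n : nat) : Prop :=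
  exists a : nat -> R, a n <> 0 /\ forall x, f x = sum_f_R0 (fun k => a k * x ^ k) n.

Definition is_poly (f : R -> R) : Prop := exists n, is_poly_deg f n.

Definition d_orthogonal (d : nat) (Q : nat -> R -> R) (L : nat -> (R -> R) -> R) : Prop :=
  (forall n, is_poly_deg (Q n) n) /\
  forall i, (i < d)%nat ->
    (forall m n, (m * d + i + 1 <= n)%nat -> L i (fun x => Q m x * Q n x) = 0) /\
    (forall n, L i (fun x => Q n x * Q (n * d + i)%nat x) <> 0).

Definition w_weight (r : nat) (beta c : R) (i k : nat) : R :=
  (-1) ^ i * Rpower (1 - c) ((beta + INR i) / INR r)
  / (INR r * Gamma beta * sqrt (INR (fact i) * poch beta i))
  * sum_f_R0 (fun s =>
       poch (- INR k) s * Rpower (1 - c) (INR s / INR r) / (INR (fact s) * poch beta s)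
       * Gamma ((beta + INR i + INR s) / INR r)
       * pFq (1 :: Delta r (- INR k + INR s) ++ ((beta + INR s + INR i) / INR r) :: nil)
             (Delta r (beta + INR s) ++ Delta r (INR s + 1))
             ((1 - c) / INR r ^ r))
     (r - 1).

Definition L_term (r : nat) (beta c : R) (i : nat) (f : R -> R) (k : nat) : R :=
  w_weight r beta c i k * poch beta k / INR (fact k) * f (INR k).

Definition L_fun (r : nat) (beta c : R) (i : nat) (f : R -> R) : R :=
  Series (L_term r beta c i f).

(* Main.v *)
Require Import Defs.
From Stdlib Require Import Reals List Arith Factorial Lra Lia Psatz.
From Coquelicot Require Import Coquelicot.
Open Scope R_scope.

(** With [lam = 1/(1-c)] and [rho = (-1)^r lam], the terms of the hypergeometric series in
    [w_ik] regroup so that, up to a constant depending on [i], [w_ik (beta)_k/k!] is the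
    integral of [u^(beta-1) u^i exp (-lam u^r) L_k(u)] over [(0, oo)], with [L_k] the Laguerre
    polynomial of parameter [beta-1].

    The operator [A = u D^2 + beta D] satisfies [A L_k = -(k+beta-1) L_(k-1)] and is symmetric
    for the weight [u^(beta-1)].  Together with an AM-GM bound this makes the coefficients
    decay faster than any power of [k], and it gives
    [sum_k (beta+k)_n <u^j exp (-lam u^r), L_k> = (-1)^n S (A^n (u^j exp (-lam u^r)))] where
    [S f = sum_k <f, L_k>].  Christoffel-Darboux shows [S (u f) = 0], so [S] is a multiple of
    the evaluation at 0, and Abel summation of the Laguerre generating function shows that the
    multiple is not zero.  As [M_n/n!] is the coefficient of [z^n] in
    [exp (rho z^r) sum_m (beta+x)_m/((beta)_m m!) z^m], it follows that [L_i (M_n) = 0] for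
    [n > i] and [L_i (M_i) <> 0]; the recurrence for [x M_n], whose lowest term is a nonzero
    multiple of [M_(n-2r+1)], then gives the orthogonality against [x^m]. *)

(** * The Gamma integral *)

(** Why a plain sum over k evaluates at 0: for the weight u^(b-1) e^(-u) the squared norm of L_k is
    Gamma(b) (b)_k/k!, and L_k(0) = (b)_k/k!. Their ratio does not depend on k, so sum_k L_k(u) is,
    up to a constant, the reproducing kernel at 0, and formally S f = Gamma(b) f(0). Why the
    exponential factor of the generating function has this shape: A u^n = n (n+b-1) u^(n-1), so A^n
    followed by evaluation at 0 reads off n! (b)_n times the coefficient of u^n. With the sign
    (-1)^n the sums against (b+k)_n become, up to these factors, the coefficients of (-z)^j exp
    (-rho z^r), which exp (rho z^r) reduces to a single power of z. The difficulty is to make the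
    formal delta function rigorous. Recurrences are finite algebra on moments, only finite sums are
    ever integrated, and the passage to infinite sums rests on rapid decay in k and on an exact
    mean-square remainder for the Laguerre generating function. *)

Lemma exp_opp_lt_1 (x : R) : 0 < x -> exp (- x) < 1.
Proof. intros Hx; rewrite <- exp_0; apply exp_increasing; lra. Qed.

Lemma filterlim_Rminus (F : (R -> Prop) -> Prop) {FF : Filter F} (f g : R -> R) (a b : R) :
  filterlim f F (locally a) -> filterlim g F (locally b) ->
  filterlim (fun x => f x - g x) F (locally (a - b)).
Proof.
  intros Hf Hg.
  apply (filterlim_comp_2 (G := locally a) (H := locally (- b)) f (fun x => - g x) Rplus Hf).
  - apply filterlim_comp with (1 := Hg), (filterlim_opp b).
  - apply (filterlim_plus a (- b)).
Qed.

(** The limit is the supremum of the values on [1, oo). For a positive integrand, a bound on the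
    partial integrals thus gives convergence. *)
Lemma filterlim_p_infty_of_increasing (F : R -> R) (M : R) :
  (forall x y, 1 <= x -> x <= y -> F x <= F y) ->
  (forall x, 1 <= x -> F x <= M) ->
  exists l, filterlim F (Rbar_locally p_infty) (locally l).
Proof.
  intros Hmono Hub.
  destruct (completeness (fun v => exists x, 1 <= x /\ v = F x)) as [l [Hl1 Hl2]].
  - exists M; intros v [x [Hx ->]]; auto.
  - exists (F 1), 1; split; [lra | easy].
  - exists l; apply filterlim_locally; intros eps.
    assert (exists x, 1 <= x /\ l - eps < F x) as [x [Hx HFx]].
    { apply Classical_Prop.NNPP; intros Hn.
      assert (l <= l - eps).
      { apply Hl2; intros v [x [Hx ->]].
        apply Rnot_lt_le; intros Hlt; apply Hn; now exists x. }
      pose proof (cond_pos eps); lra. }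
    exists x; intros y Hy.
    assert (F y <= l) by (apply Hl1; exists y; split; [lra | easy]).
    assert (F x <= F y) by (apply Hmono; lra).
    change (Rabs (F y - l) < eps).
    apply Rabs_def1; pose proof (cond_pos eps); lra.
Qed.

(** The map x -> 1/x with a change of sign carries the end 0 to infinity and keeps monotonicity. *)
Lemma filterlim_at_right_0_of_increasing (F : R -> R) (m : R) :
  (forall x y, 0 < x -> x <= y -> y <= 1 -> F x <= F y) ->
  (forall x, 0 < x <= 1 -> m <= F x) ->
  exists l, filterlim F (at_right 0) (locally l).
Proof.
  intros Hmono Hlb.
  destruct (filterlim_p_infty_of_increasing (fun x => - F (/ x)) (- m)) as [l Hl].
  - intros x y Hx Hxy.
    apply Ropp_le_contravar, Hmono.
    + apply Rinv_0_lt_compat; lra.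
    + apply Rinv_le_contravar; lra.
    + rewrite <- Rinv_1; apply Rinv_le_contravar; lra.
  - intros x Hx.
    apply Ropp_le_contravar, Hlb; split.
    + apply Rinv_0_lt_compat; lra.
    + rewrite <- Rinv_1; apply Rinv_le_contravar; lra.
  - exists (- l).
    apply filterlim_ext_loc with (f := fun x => - - F (/ / x)).
    + exists posreal_one; intros y _ Hy.
      rewrite Rinv_inv; ring.
    + apply filterlim_comp with (G := locally l) (f := fun x => - F (/ / x)) (g := Ropp).
      * apply filterlim_comp with (G := Rbar_locally p_infty) (f := Rinv) (g := fun x => - F (/ x)); [|exact Hl].
        apply filterlim_Rinv_0_right.
      * apply (filterlim_opp l).
Qed.

(** A primitive with limits at both ends gives existence and value at once, so integration by parts
    and substitution become manipulations of primitives. *)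
Lemma is_RInt_gen_primitive (f F : R -> R) (l0 l1 : R) :
  (forall x, 0 < x -> is_derive F x (f x)) ->
  (forall x, 0 < x -> continuous f x) ->
  filterlim F (at_right 0) (locally l0) ->
  filterlim F (Rbar_locally p_infty) (locally l1) ->
  is_RInt_gen f (at_right 0) (Rbar_locally p_infty) (l1 - l0).
Proof.
  intros HF Hf H0 H1.
  assert (Hpos : filter_prod (at_right 0) (Rbar_locally p_infty)
                   (fun ab : R * R => 0 < Rmin (fst ab) (snd ab))).
  { apply Filter_prod with (Q := fun x => 0 < x) (R := fun x => 0 < x).
    - exists posreal_one; intros y _ Hy; exact Hy.
    - exists 0; intros y Hy; exact Hy.
    - intros x y Hx Hy; now apply Rmin_glb_lt. }
  apply is_RInt_gen_ext with (f := Derive F).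
  - revert Hpos; apply filter_imp; intros [a b] Hab x [Hx _]; simpl in *.
    apply is_derive_unique, HF; lra.
  - apply is_RInt_gen_Derive; try assumption.
    + revert Hpos; apply filter_imp; intros [a b] Hab x [Hx _]; simpl in *.
      exists (f x); apply HF; lra.
    + revert Hpos; apply filter_imp; intros [a b] Hab x [Hx _]; simpl in *.
      assert (Hx0 : 0 < x) by lra.
      apply continuous_ext_loc with (g := f); [|now apply Hf].
      exists (mkposreal x Hx0); intros y Hy.
      symmetry; apply is_derive_unique, HF.
      change (Rabs (y - x) < x) in Hy; apply Rabs_def2 in Hy; lra.
Qed.

(** The constant is the maximum of y^a e^(-y/2), reached at y = 2a; the inequality is ln v <= v - 1
    at v = y/(2a). *)
Lemma Rpower_exp_bound (a y : R) :
  0 < a -> 0 < y ->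
  Rpower y a * exp (- y) <= exp (a * ln (2 * a) - a) * exp (- (y / 2)).
Proof.
  intros Ha Hy; unfold Rpower; rewrite <- !exp_plus.
  assert (Hln : ln (y / (2 * a)) <= y / (2 * a) - 1).
  { assert (Hp : 0 < y / (2 * a)) by (apply Rdiv_lt_0_compat; lra).
    pose proof (exp_ineq1_le (ln (y / (2 * a)))) as He.
    rewrite exp_ln in He by exact Hp; lra. }
  rewrite ln_div in Hln by lra.
  assert (a * (ln y - ln (2 * a)) <= a * (y / (2 * a) - 1)) as Hm
    by (apply Rmult_le_compat_l; lra).
  replace (a * (y / (2 * a) - 1)) with (y / 2 - a) in Hm by (field; lra).
  assert (a * ln y + - y <= a * ln (2 * a) - a + - (y / 2)) as [Hl | ->] by lra; [|lra].
  left; now apply exp_increasing.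
Qed.

Lemma filterlim_exp_half_p_infty (K : R) :
  filterlim (fun y => K * exp (- (y / 2))) (Rbar_locally p_infty) (locally 0).
Proof.
  replace 0 with (K * 0) by ring.
  apply filterlim_comp with (f := fun y => exp (- (y / 2))) (G := locally 0) (g := fun v => K * v).
  - apply filterlim_comp with (f := fun y => - (y / 2)) (G := Rbar_locally m_infty) (g := exp);
      [|exact is_lim_exp_m].
    intros P [A HA]; exists (2 * - A); intros y Hy; apply HA; lra.
  - apply (filterlim_scal_r K 0).
Qed.

Lemma filterlim_Rpower_exp_p_infty (a : R) :
  0 < a -> filterlim (fun y => Rpower y a * exp (- y)) (Rbar_locally p_infty) (locally 0).
Proof.
  intros Ha.
  apply (filterlim_le_le (F := Rbar_locally p_infty) (fun _ => 0) _
           (fun y => exp (a * ln (2 * a) - a) * exp (- (y / 2))) (Finite 0)).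
  - exists 0; intros y Hy; split.
    + apply Rlt_le, Rmult_lt_0_compat; apply exp_pos.
    + now apply Rpower_exp_bound.
  - apply filterlim_const.
  - apply filterlim_exp_half_p_infty.
Qed.

Lemma filterlim_Rpower_at_right_0 (a : R) :
  0 < a -> filterlim (fun y => Rpower y a) (at_right 0) (locally 0).
Proof.
  intros Ha.
  apply filterlim_comp with (f := fun y => a * ln y) (G := Rbar_locally m_infty) (g := exp);
    [|exact is_lim_exp_m].
  apply filterlim_comp with (f := ln) (G := Rbar_locally m_infty) (g := fun v => a * v);
    [exact is_lim_ln_0|].
  intros P [A HA]; exists (A / a); intros y Hy; apply HA.
  apply (Rmult_lt_compat_l a) in Hy; [|exact Ha].
  replace (a * (A / a)) with A in Hy by (field; lra); exact Hy.
Qed.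

Lemma filterlim_Rpower_exp_at_right_0 (a : R) :
  0 < a -> filterlim (fun y => Rpower y a * exp (- y)) (at_right 0) (locally 0).
Proof.
  intros Ha.
  apply (filterlim_le_le (F := at_right 0) (fun _ => 0) _ (fun y => Rpower y a) (Finite 0)).
  - exists posreal_one; intros y _ Hy; split.
    + apply Rlt_le, Rmult_lt_0_compat; apply exp_pos.
    + assert (exp (- y) < 1) by (apply exp_opp_lt_1; lra).
      assert (0 < Rpower y a) by apply exp_pos; nra.
  - apply filterlim_const.
  - now apply filterlim_Rpower_at_right_0.
Qed.

Lemma is_derive_Rpower (a x : R) :
  0 < x -> is_derive (fun u => Rpower u a) x (a * Rpower x (a - 1)).
Proof.
  intros Hx; apply is_derive_Reals.
  now apply derivable_pt_lim_power.
Qed.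

Lemma continuous_Rpower_mult (a x : R) (g : R -> R) :
  0 < x -> continuous g x -> continuous (fun u => Rpower u a * g u) x.
Proof.
  intros Hx Hg; apply (continuous_mult (fun u => Rpower u a) g); [|exact Hg].
  apply (ex_derive_continuous (fun u => Rpower u a)).
  exists (a * Rpower x (a - 1)); now apply is_derive_Rpower.
Qed.

Lemma continuous_exp_opp (x : R) : continuous (fun t => exp (- t)) x.
Proof. apply (ex_derive_continuous (fun t : R => exp (- t))); auto_derive; easy. Qed.

(** The primitive itself is exported, because the functional equation and the substitution t = lam
    u^r are proved by transforming it. The strict inequality [l0 < l1] yields positivity of
    Gamma. *)
Lemma Gamma_primitive (a : R) :
  0 < a ->
  exists F l0 l1,
    (forall x, 0 < x -> is_derive F x (Rpower x (a - 1) * exp (- x))) /\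
    filterlim F (at_right 0) (locally l0) /\
    filterlim F (Rbar_locally p_infty) (locally l1) /\ l0 < l1.
Proof.
  intros Ha.
  set (f := fun t => Rpower t (a - 1) * exp (- t)).
  assert (Hc : forall x, 0 < x -> continuous f x)
    by (intros x Hx; apply continuous_Rpower_mult; [easy | apply continuous_exp_opp]).
  assert (Hex : forall x y, 0 < x -> 0 < y -> ex_RInt f x y).
  { intros x y Hx Hy; apply (ex_RInt_continuous f).
    intros z [Hz _]; apply Hc.
    pose proof (Rmin_glb_lt x y 0 Hx Hy); lra. }
  assert (Hd : forall x, 0 < x -> is_derive (fun y => RInt f 1 y) x (f x)).
  { intros x Hx; apply (is_derive_RInt f _ 1).
    - exists (mkposreal x Hx); intros y Hy.
      change (Rabs (y - x) < x) in Hy; apply Rabs_def2 in Hy.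
      apply (RInt_correct f), Hex; lra.
    - now apply Hc. }
  assert (Hdiff : forall x y, 0 < x -> 0 < y -> RInt f 1 y - RInt f 1 x = RInt f x y).
  { intros x y Hx Hy.
    rewrite <- (RInt_Chasles f 1 x y) by (apply Hex; lra).
    unfold plus; simpl; ring. }
  assert (Hfpos : forall x, 0 < f x) by (intros x; apply Rmult_lt_0_compat; apply exp_pos).
  assert (Hmono : forall x y, 0 < x -> x <= y -> RInt f 1 x <= RInt f 1 y).
  { intros x y Hx Hxy.
    assert (0 <= RInt f x y); [|specialize (Hdiff x y); lra].
    apply RInt_ge_0; [easy | apply Hex; lra |].
    intros z _; apply Rlt_le, Hfpos. }
  set (K := exp (a * ln (2 * a) - a)).
  assert (HK : 0 < K) by apply exp_pos.
  assert (Hg : forall x y, is_RInt (fun t => K * exp (- (t / 2))) x y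
      (- 2 * K * exp (- (y / 2)) - (- 2 * K * exp (- (x / 2))))).
  { intros x y.
    apply (is_RInt_derive (fun t => - 2 * K * exp (- (t / 2)))).
    - intros z _; auto_derive; [easy | lra].
    - intros z _; apply (ex_derive_continuous (fun t => K * exp (- (t / 2)))).
      auto_derive; easy. }
  (* On [1, oo) the integrand is at most t^a e^(-t), hence at most K e^(-t/2), whose integral from 1
     stays below 2K. *)
  destruct (filterlim_p_infty_of_increasing (fun y => RInt f 1 y) (2 * K)) as [l1 Hl1].
  { intros x y Hx Hxy; apply Hmono; lra. }
  { intros x Hx.
    apply Rle_trans with (- 2 * K * exp (- (x / 2)) - (- 2 * K * exp (- (1 / 2)))).
    - apply (is_RInt_le f (fun t => K * exp (- (t / 2))) 1 x); [lra | | apply Hg |].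
      + apply (RInt_correct f), Hex; lra.
      + intros t Ht.
        apply Rle_trans with (Rpower t a * exp (- t)).
        * apply Rmult_le_compat_r; [apply Rlt_le, exp_pos|].
          apply Rle_Rpower; lra.
        * apply Rpower_exp_bound; lra.
    - pose proof (exp_pos (- (x / 2))).
      assert (exp (- (1 / 2)) < 1) by (apply exp_opp_lt_1; lra).
      assert (0 < K * exp (- (x / 2))) by (apply Rmult_lt_0_compat; lra).
      assert (K * exp (- (1 / 2)) < K * 1) by (apply Rmult_lt_compat_l; lra).
      lra. }
  (* On (0, 1] the integrand is at most t^(a-1), whose integral from x to 1 is (1 - x^a)/a. *)
  destruct (filterlim_at_right_0_of_increasing (fun y => RInt f 1 y) (- / a)) as [l0 Hl0].
  { intros x y Hx Hxy Hy; now apply Hmono. }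
  { intros x Hx.
    assert (RInt f x 1 <= / a * Rpower 1 a - / a * Rpower x a).
    { apply (is_RInt_le f (fun t => Rpower t (a - 1)) x 1); [lra | | |].
      - apply (RInt_correct f), Hex; lra.
      - apply (is_RInt_derive (fun t => / a * Rpower t a)).
        + intros z [Hz _]; rewrite Rmin_left in Hz by lra.
          replace (Rpower z (a - 1)) with (/ a * (a * Rpower z (a - 1))) by (field; lra).
          apply (is_derive_scal (fun t => Rpower t a)), is_derive_Rpower; lra.
        + intros z [Hz _]; rewrite Rmin_left in Hz by lra.
          apply (ex_derive_continuous (fun u => Rpower u (a - 1))).
          eexists; apply is_derive_Rpower; lra.
      - intros t Ht; unfold f.
        assert (exp (- t) < 1) by (apply exp_opp_lt_1; lra).
        assert (0 < Rpower t (a - 1)) by apply exp_pos; nra. }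
    assert (0 < / a * Rpower x a)
      by (apply Rmult_lt_0_compat; [apply Rinv_0_lt_compat; lra | apply exp_pos]).
    unfold Rpower at 1 in H; rewrite ln_1, Rmult_0_r, exp_0 in H.
    specialize (Hdiff x 1); rewrite RInt_point in Hdiff.
    unfold zero in Hdiff; simpl in Hdiff; lra. }
  exists (fun y => RInt f 1 y), l0, l1; split; [exact Hd | split; [exact Hl0 | split; [exact Hl1 |]]].
  assert (RInt f 1 1 < RInt f 1 2).
  { rewrite RInt_point; apply RInt_gt_0; [lra | intros y _; apply Hfpos |].
    intros y Hy; apply Hc; lra. }
  assert (l0 <= RInt f 1 1).
  { change (Rbar_le (Finite l0) (Finite (RInt f 1 1))).
    apply (filterlim_le (F := at_right 0) (fun y => RInt f 1 y) (fun _ => RInt f 1 1)).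
    - exists posreal_one; intros y Hy Hy0.
      change (Rabs (y - 0) < 1) in Hy; apply Rabs_def2 in Hy; apply Hmono; lra.
    - exact Hl0.
    - apply filterlim_const. }
  assert (RInt f 1 2 <= l1); [|lra].
  change (Rbar_le (Finite (RInt f 1 2)) (Finite l1)).
  apply (filterlim_le (F := Rbar_locally p_infty) (fun _ => RInt f 1 2) (fun y => RInt f 1 y)).
  - exists 2; intros y Hy; apply Hmono; lra.
  - apply filterlim_const.
  - exact Hl1.
Qed.

Lemma continuous_Gamma_integrand (a x : R) :
  0 < x -> continuous (fun t => Rpower t (a - 1) * exp (- t)) x.
Proof. intros Hx; apply continuous_Rpower_mult; [easy | apply continuous_exp_opp]. Qed.

Lemma Gamma_pos (a : R) : 0 < a -> 0 < Gamma a.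
Proof.
  intros Ha; destruct (Gamma_primitive a Ha) as (F & l0 & l1 & HF & H0 & H1 & Hl).
  replace (Gamma a) with (l1 - l0); [lra|].
  symmetry; apply is_RInt_gen_unique.
  apply is_RInt_gen_primitive with F; try assumption.
  intros x Hx; now apply continuous_Gamma_integrand.
Qed.

(** Integration by parts on primitives: a F(y) - y^a e^(-y) is a primitive of y^a e^(-y), and the
    subtracted term tends to 0 at both ends. *)
Lemma Gamma_S (a : R) : 0 < a -> Gamma (a + 1) = a * Gamma a.
Proof.
  intros Ha; destruct (Gamma_primitive a Ha) as (F & l0 & l1 & HF & H0 & H1 & Hl).
  assert (HG : Gamma a = l1 - l0).
  { apply is_RInt_gen_unique.
    apply is_RInt_gen_primitive with F; try assumption.
    intros x Hx; now apply continuous_Gamma_integrand. }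
  rewrite HG.
  replace (a * (l1 - l0)) with ((a * l1 - 0) - (a * l0 - 0)) by ring.
  apply is_RInt_gen_unique.
  apply is_RInt_gen_primitive with (fun y => a * F y - Rpower y a * exp (- y)).
  - intros x Hx.
    replace (Rpower x (a + 1 - 1) * exp (- x)) with
      (a * (Rpower x (a - 1) * exp (- x)) -
       (a * Rpower x (a - 1) * exp (- x) + Rpower x a * (- 1 * exp (- x))))
      by (replace (a + 1 - 1) with a by ring; ring).
    apply (is_derive_minus (fun y => a * F y)).
    + apply (is_derive_scal F); now apply HF.
    + apply (is_derive_mult (fun y => Rpower y a) (fun y => exp (- y))).
      * now apply is_derive_Rpower.
      * auto_derive; [easy | ring].
      * intros; apply Rmult_comm.
  - intros x Hx; now apply continuous_Gamma_integrand.
  - apply filterlim_Rminus; [typeclasses eauto | |].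
    + apply filterlim_comp with (1 := H0), (filterlim_scal_r a l0).
    + now apply filterlim_Rpower_exp_at_right_0.
  - apply filterlim_Rminus; [typeclasses eauto | |].
    + apply filterlim_comp with (1 := H1), (filterlim_scal_r a l1).
    + now apply filterlim_Rpower_exp_p_infty.
Qed.

(** Substitution t = lam u^r, made on the Gamma primitive. The inner map sends each end to itself,
    by u^r <= u for u < 1 and u <= u^r for u > 1. *)
Lemma is_RInt_gen_Rpower_exp_pow (a lam : R) (r : nat) :
  0 < a -> 0 < lam -> (1 <= r)%nat ->
  is_RInt_gen (fun u => Rpower u (a - 1) * exp (- (lam * u ^ r)))
    (at_right 0) (Rbar_locally p_infty)
    (Rpower lam (- (a / INR r)) * Gamma (a / INR r) / INR r).
Proof.
  intros Ha Hlam Hr.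
  assert (HrR : 1 <= INR r) by (apply (le_INR 1); exact Hr).
  assert (Har : 0 < a / INR r) by (apply Rdiv_lt_0_compat; lra).
  destruct (Gamma_primitive _ Har) as (F & l0 & l1 & HF & H0 & H1 & Hl).
  assert (HG : Gamma (a / INR r) = l1 - l0).
  { apply is_RInt_gen_unique.
    apply is_RInt_gen_primitive with F; try assumption.
    intros x Hx; now apply continuous_Gamma_integrand. }
  rewrite HG.
  set (K := Rpower lam (- (a / INR r)) / INR r).
  replace (Rpower lam (- (a / INR r)) * (l1 - l0) / INR r) with (K * l1 - K * l0)
    by (unfold K; field; lra).
  assert (Hpow : forall u, 0 < u -> 0 < lam * u ^ r)
    by (intros u Hu; apply Rmult_lt_0_compat; [easy | now apply pow_lt]).
  apply is_RInt_gen_primitive with (fun u => K * F (lam * u ^ r)).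
  - intros u Hu.
    replace (Rpower u (a - 1) * exp (- (lam * u ^ r))) with
      (K * ((lam * (INR r * u ^ pred r)) *
            (Rpower (lam * u ^ r) (a / INR r - 1) * exp (- (lam * u ^ r))))).
    + apply (is_derive_scal (fun v => F (lam * v ^ r))).
      apply (is_derive_comp F (fun v => lam * v ^ r)).
      * now apply HF, Hpow.
      * apply (is_derive_scal (fun v => v ^ r)).
        replace (INR r * u ^ pred r) with (INR r * 1 * u ^ pred r) by ring.
        apply (is_derive_pow (fun v => v) r u 1 (is_derive_id u)).
    + rewrite <- Rpower_mult_distr by (try apply pow_lt; assumption).
      rewrite <- (Rpower_pow r u) by exact Hu.
      rewrite <- (Rpower_pow (pred r) u) by exact Hu.
      rewrite Rpower_mult.
      replace (INR (pred r)) with (INR r - 1)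
        by (rewrite <- (Nat.succ_pred_pos r) at 1 by lia; rewrite S_INR; ring).
      replace (INR r * (a / INR r - 1)) with (a - INR r) by (field; lra).
      transitivity ((Rpower lam (- (a / INR r)) * lam * Rpower lam (a / INR r - 1)) *
        (Rpower u (INR r - 1) * Rpower u (a - INR r)) * exp (- (lam * Rpower u (INR r)))).
      * unfold K; field; lra.
      * rewrite <- (Rpower_1 lam) at 2 by exact Hlam.
        rewrite <- !Rpower_plus.
        replace (- (a / INR r) + 1 + (a / INR r - 1)) with 0 by ring.
        rewrite Rpower_O by exact Hlam.
        replace (INR r - 1 + (a - INR r)) with (a - 1) by ring; ring.
  - intros u Hu; apply continuous_Rpower_mult; [easy|].
    apply (ex_derive_continuous (fun v => exp (- (lam * v ^ r)))); auto_derive; easy.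
  - apply filterlim_comp with (f := fun u => F (lam * u ^ r)) (G := locally l0) (g := fun v => K * v);
      [|apply (filterlim_scal_r K l0)].
    apply filterlim_comp with (f := fun u => lam * u ^ r) (G := at_right 0) (g := F); [|exact H0].
    intros P [eps HP].
    assert (He : 0 < Rmin 1 (eps / lam)).
    { apply Rmin_glb_lt; [lra|]. apply Rdiv_lt_0_compat; [apply cond_pos | easy]. }
    exists (mkposreal _ He); intros u Hu Hu0.
    change (Rabs (u - 0) < Rmin 1 (eps / lam)) in Hu.
    rewrite Rminus_0_r, Rabs_right in Hu by lra.
    apply HP; [|now apply Hpow].
    change (Rabs (lam * u ^ r - 0) < eps).
    rewrite Rminus_0_r, Rabs_right by (apply Rle_ge, Rlt_le, Hpow; exact Hu0).
    assert (u < 1) by (eapply Rlt_le_trans; [exact Hu | apply Rmin_l]).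
    assert (u < eps / lam) by (eapply Rlt_le_trans; [exact Hu | apply Rmin_r]).
    assert (u ^ r <= u).
    { replace r with (S (pred r)) by lia; simpl.
      assert (u ^ pred r <= 1) by (rewrite <- (pow1 (pred r)); apply pow_incr; lra).
      nra. }
    apply Rle_lt_trans with (lam * u); [apply Rmult_le_compat_l; lra|].
    apply (Rmult_lt_compat_l lam) in H2; [|exact Hlam].
    replace (lam * (eps / lam)) with (pos eps) in H2 by (field; lra); exact H2.
  - apply filterlim_comp with (f := fun u => F (lam * u ^ r)) (G := locally l1) (g := fun v => K * v);
      [|apply (filterlim_scal_r K l1)].
    apply filterlim_comp with (f := fun u => lam * u ^ r) (G := Rbar_locally p_infty) (g := F); [|exact H1].
    intros P [A HA]; exists (Rmax 1 (A / lam)); intros u Hu; apply HA.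
    assert (1 < u) by (eapply Rle_lt_trans; [apply Rmax_l | exact Hu]).
    assert (A / lam < u) by (eapply Rle_lt_trans; [apply Rmax_r | exact Hu]).
    assert (u <= u ^ r).
    { replace r with (S (pred r)) by lia; simpl.
      assert (1 <= u ^ pred r) by (rewrite <- (pow1 (pred r)); apply pow_incr; lra).
      nra. }
    apply Rlt_le_trans with (lam * u); [|apply Rmult_le_compat_l; lra].
    apply (Rmult_lt_compat_l lam) in H2; [|exact Hlam].
    replace (lam * (A / lam)) with A in H2 by (field; lra); exact H2.
Qed.

(** * Pochhammer symbols and Laguerre coefficients *)

Lemma poch_pos (a : R) (n : nat) : 0 < a -> 0 < poch a n.
Proof.
  intros Ha; induction n as [|n IH]; simpl; [lra|].
  pose proof (pos_INR n); apply Rmult_lt_0_compat; [exact IH | lra].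
Qed.

Lemma poch_add (a : R) (n p : nat) : poch a (n + p) = poch a n * poch (a + INR n) p.
Proof.
  induction p as [|p IH]; [rewrite Nat.add_0_r; simpl; ring|].
  rewrite Nat.add_succ_r; simpl; rewrite IH, plus_INR; ring.
Qed.

Lemma poch_S_l (a : R) (n : nat) : poch a (S n) = a * poch (a + 1) n.
Proof. change (S n) with (1 + n)%nat; rewrite poch_add; simpl; rewrite Rplus_0_r; ring. Qed.

Lemma poch_opp_INR_0 (k l : nat) : (k < l)%nat -> poch (- INR k) l = 0.
Proof.
  intros Hkl; replace l with (S k + (l - S k))%nat by lia.
  rewrite poch_add; simpl; ring.
Qed.

Lemma poch_opp_S (k l : nat) : poch (- INR (S k)) (S l) = - INR (S k) * poch (- INR k) l.
Proof. rewrite poch_S_l, S_INR; do 2 f_equal; ring. Qed.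

Lemma poch_opp_pascal (n l : nat) :
  poch (- INR (S n)) (S l) = poch (- INR n) (S l) - INR (S l) * poch (- INR n) l.
Proof. rewrite poch_opp_S; simpl poch; rewrite !S_INR; ring. Qed.

Lemma poch_opp_INR_diag (n : nat) : poch (- INR n) n = (-1) ^ n * INR (fact n).
Proof.
  induction n as [|n IH]; [simpl; ring|].
  rewrite poch_opp_S, IH, fact_simpl, mult_INR; simpl pow; ring.
Qed.

Lemma sum_f_R0_extend (u : nat -> R) (n m : nat) :
  (n <= m)%nat -> (forall l, (n < l <= m)%nat -> u l = 0) -> sum_f_R0 u m = sum_f_R0 u n.
Proof.
  intros Hnm; induction Hnm as [|m Hnm IH]; intros Hu; [easy|].
  simpl; rewrite (Hu (S m)) by lia.
  rewrite IH; [ring | intros; apply Hu; lia].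
Qed.

Lemma sum_f_R0_shift (u : nat -> R) (n : nat) :
  sum_f_R0 u (S n) = u 0%nat + sum_f_R0 (fun l => u (S l)) n.
Proof. rewrite decomp_sum by lia; reflexivity. Qed.

(** Induction on n with y and b free: Pascal's rule for (-n-1)_(l+1) splits the sum into the one for
    n and the one for n with y + 1 and b + 1, for which b - y is unchanged. *)
Lemma chu_vandermonde (n : nat) : forall y b, 0 < b ->
  sum_f_R0 (fun l => poch (- INR n) l * poch y l / (INR (fact l) * poch b l)) n
  = poch (b - y) n / poch b n.
Proof.
  induction n as [|n IH]; intros y b Hb; [simpl; field|].
  pose proof (poch_pos b n Hb) as Hp.
  assert (Hp1 : 0 < poch (b + 1) n) by (apply poch_pos; lra).
  pose proof (pos_INR n) as Hn.
  rewrite sum_f_R0_shift.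
  rewrite (sum_eq _ (fun l =>
    poch (- INR n) (S l) * poch y (S l) / (INR (fact (S l)) * poch b (S l)) +
    poch (- INR n) l * poch (y + 1) l / (INR (fact l) * poch (b + 1) l) * (- (y / b)))).
  2:{ intros l _; rewrite poch_opp_pascal.
      assert (0 < poch (b + 1) l) by (apply poch_pos; lra).
      pose proof (INR_fact_lt_0 l); pose proof (pos_INR l).
      rewrite (poch_S_l y), (poch_S_l b), fact_simpl, mult_INR, !S_INR.
      field; repeat split; lra. }
  rewrite plus_sum, <- scal_sum, IH by lra.
  replace (b + 1 - (y + 1)) with (b - y) by ring.
  transitivity (sum_f_R0 (fun l => poch (- INR n) l * poch y l / (INR (fact l) * poch b l)) (S n)
     + - (y / b) * (poch (b - y) n / poch (b + 1) n)).
  { rewrite sum_f_R0_shift; simpl poch; simpl fact; field; repeat split; simpl; lra. }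
  rewrite (sum_f_R0_extend _ n (S n)), IH; [| lra | lia |].
  - assert (Hb1 : poch (b + 1) n = poch b n * (b + INR n) / b).
    { transitivity (b * poch (b + 1) n / b); [field; lra|].
      now rewrite <- poch_S_l. }
    rewrite Hb1; simpl poch; field; lra.
  - intros l Hl; rewrite poch_opp_INR_0 by lia; unfold Rdiv; ring.
Qed.

(** * Gauss multiplication for the parameter lists *)

Lemma prod_map_mult (f g : R -> R) (s : list R) :
  fold_right Rmult 1 (map (fun x => f x * g x) s)
  = fold_right Rmult 1 (map f s) * fold_right Rmult 1 (map g s).
Proof. induction s as [|x s IH]; simpl; [ring | rewrite IH; ring]. Qed.

Lemma prod_Delta_add (r : nat) (a : R) (m : nat) :
  (1 <= r)%nat ->
  fold_right Rmult 1 (map (fun x => x + INR m) (Defs.Delta r a)) * INR r ^ r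
  = poch (a + INR (r * m)) r.
Proof.
  intros Hr; unfold Defs.Delta; rewrite map_map.
  assert (HrR : 1 <= INR r) by (apply (le_INR 1); exact Hr).
  assert (H : forall n, fold_right Rmult 1
      (map (fun j => (a + INR j) / INR r + INR m) (seq 0 n)) * INR r ^ n
      = poch (a + INR (r * m)) n); [|apply H].
  induction n as [|n IH]; [simpl; ring|].
  rewrite seq_S, map_app, fold_right_app; simpl.
  replace (fold_right Rmult (((a + INR n) / INR r + INR m) * 1)
             (map (fun j => (a + INR j) / INR r + INR m) (seq 0 n)))
    with (fold_right Rmult 1 (map (fun j => (a + INR j) / INR r + INR m) (seq 0 n))
          * ((a + INR n) / INR r + INR m)).
  - rewrite <- IH, mult_INR; field; lra.
  - generalize (map (fun j => (a + INR j) / INR r + INR m) (seq 0 n)).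
    intros s; induction s as [|x s IHs]; simpl; [ring|].
    rewrite <- IHs; ring.
Qed.

(** Gauss multiplication formula. Each step of the induction adds a block of r consecutive factors
    of (a)_(rm), one from each parameter of the list. *)
Lemma poch_Delta (r : nat) (a : R) (m : nat) :
  (1 <= r)%nat ->
  fold_right Rmult 1 (map (fun x => poch x m) (Defs.Delta r a)) * INR r ^ (r * m) = poch a (r * m).
Proof.
  intros Hr; induction m as [|m IH].
  - rewrite Nat.mul_0_r; simpl.
    induction (Defs.Delta r a) as [|x s IHs]; simpl in *; [ring | lra].
  - simpl poch; rewrite prod_map_mult.
    replace (r * S m)%nat with (r * m + r)%nat by lia.
    rewrite poch_add, pow_add, <- prod_Delta_add, <- IH by exact Hr; ring.
Qed.

Lemma Gamma_add (a : R) (m : nat) : 0 < a -> Gamma (a + INR m) = Gamma a * poch a m.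
Proof.
  intros Ha; induction m as [|m IH]; [simpl; rewrite Rplus_0_r; ring|].
  pose proof (pos_INR m).
  rewrite S_INR, <- Rplus_assoc, Gamma_S, IH by lra; simpl; ring.
Qed.

(** Coefficient of u^l in the Laguerre polynomial written as ((b)_k/k!) 1F1(-k; b; u). The factor
    (-k)_l makes it 0 for l > k, so sums for different k can be brought to a common range. *)
Definition laguerre_coef (b : R) (k l : nat) : R :=
  poch (- INR k) l * poch b k / (INR (fact k) * (INR (fact l) * poch b l)).

(** The integral of u^j L_k(u) against a measure with moments [m]. The sequence stays abstract so
    that the recurrences are finite algebra and the definition also serves the measures with e^(-u)
    and e^(-u/(1-t)). *)
Definition laguerre_functional (b : R) (m : nat -> R) (k j : nat) : R :=
  sum_f_R0 (fun l => laguerre_coef b k l * m (j + l)%nat) k.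

Lemma laguerre_coef_0 (b : R) (k l : nat) : (k < l)%nat -> laguerre_coef b k l = 0.
Proof.
  intros H; unfold laguerre_coef; rewrite poch_opp_INR_0 by exact H; unfold Rdiv; ring.
Qed.

Lemma laguerre_functional_extend (b : R) (m : nat -> R) (k j N : nat) :
  (k <= N)%nat ->
  laguerre_functional b m k j = sum_f_R0 (fun l => laguerre_coef b k l * m (j + l)%nat) N.
Proof.
  intros HN; symmetry; apply sum_f_R0_extend; [exact HN|].
  intros l Hl; rewrite laguerre_coef_0 by lia; ring.
Qed.

(** Since A u^(l+1) = (l+1)(l+b) u^l, this is A L_(k+1) = -(k+b) L_k read at u^l. *)
Lemma laguerre_coef_lower (b : R) (k l : nat) :
  0 < b ->
  laguerre_coef b (S k) (S l) * (INR (S l) * (INR l + b)) = - (INR k + b) * laguerre_coef b k l.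
Proof.
  intros Hb; unfold laguerre_coef; rewrite poch_opp_S.
  pose proof (poch_pos b k Hb); pose proof (poch_pos b l Hb).
  pose proof (INR_fact_lt_0 k); pose proof (INR_fact_lt_0 l).
  pose proof (pos_INR l); pose proof (pos_INR k).
  rewrite !fact_simpl, !mult_INR, !S_INR; simpl poch; field; repeat split; lra.
Qed.

(** The classical recurrence for u L_(k+1), read at u^(l+1). At u^0 the left side has no term, which
    is the next lemma. *)
Lemma laguerre_coef_three_term (b : R) (k l : nat) :
  0 < b ->
  laguerre_coef b (S k) l =
  - INR (S (S k)) * laguerre_coef b (S (S k)) (S l)
  + (2 * INR (S k) + b) * laguerre_coef b (S k) (S l)
  - (INR k + b) * laguerre_coef b k (S l).
Proof.
  intros Hb; unfold laguerre_coef.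
  pose proof (poch_pos b k Hb); pose proof (poch_pos b l Hb).
  pose proof (INR_fact_lt_0 k); pose proof (INR_fact_lt_0 l).
  pose proof (pos_INR l); pose proof (pos_INR k).
  destruct l as [|l].
  - rewrite !fact_simpl, !mult_INR; cbn [poch]; rewrite !S_INR.
    change (fact 0) with 1%nat; change (INR 1) with 1; change (INR 0) with 0.
    field; repeat split; lra.
  - rewrite !(poch_opp_S (S k)), !(poch_opp_S k).
    pose proof (poch_pos b l Hb); pose proof (INR_fact_lt_0 l); pose proof (pos_INR l).
    rewrite !fact_simpl, !mult_INR; cbn [poch]; rewrite !S_INR.
    field; repeat split; lra.
Qed.

Lemma laguerre_coef_three_term_0 (b : R) (k : nat) :
  0 < b ->
  - INR (S (S k)) * laguerre_coef b (S (S k)) 0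
  + (2 * INR (S k) + b) * laguerre_coef b (S k) 0
  - (INR k + b) * laguerre_coef b k 0 = 0.
Proof.
  intros Hb; unfold laguerre_coef.
  pose proof (poch_pos b k Hb); pose proof (INR_fact_lt_0 k); pose proof (pos_INR k).
  rewrite !fact_simpl, !mult_INR; cbn [poch]; rewrite !S_INR.
  change (fact 0) with 1%nat; change (INR 1) with 1; field; repeat split; lra.
Qed.

Lemma laguerre_functional_three_term (b : R) (m : nat -> R) (k j : nat) :
  0 < b ->
  laguerre_functional b m (S k) (S j) =
  - INR (S (S k)) * laguerre_functional b m (S (S k)) j
  + (2 * INR (S k) + b) * laguerre_functional b m (S k) j
  - (INR k + b) * laguerre_functional b m k j.
Proof.
  intros Hb.
  rewrite (laguerre_functional_extend b m (S k) (S j) (S (S k))) by lia.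
  rewrite (laguerre_functional_extend b m (S (S k)) j (S (S (S k)))) by lia.
  rewrite (laguerre_functional_extend b m (S k) j (S (S (S k)))) by lia.
  rewrite (laguerre_functional_extend b m k j (S (S (S k)))) by lia.
  rewrite !(scal_sum _ (S (S (S k)))), <- plus_sum, <- minus_sum, (sum_f_R0_shift _ (S (S k))).
  rewrite <- (Rplus_0_l (sum_f_R0 _ (S (S k)))) at 1; f_equal.
  - transitivity ((- INR (S (S k)) * laguerre_coef b (S (S k)) 0
      + (2 * INR (S k) + b) * laguerre_coef b (S k) 0
      - (INR k + b) * laguerre_coef b k 0) * m (j + 0)%nat); [|ring].
    rewrite laguerre_coef_three_term_0 by exact Hb; ring.
  - apply sum_eq; intros l _.
    rewrite (laguerre_coef_three_term b k l Hb).
    replace (S j + l)%nat with (j + S l)%nat by lia; ring.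
Qed.

(** The three-term recurrence telescopes: Christoffel-Darboux with one point at 0, where the kernel
    is a multiple of the plain sum of the L_k. *)
Lemma sum_laguerre_functional_S (b : R) (m : nat -> R) (n j : nat) :
  0 < b ->
  sum_f_R0 (fun k => laguerre_functional b m k (S j)) n =
  (INR n + b) * laguerre_functional b m n j - INR (S n) * laguerre_functional b m (S n) j.
Proof.
  intros Hb; induction n as [|n IH].
  - unfold laguerre_functional, laguerre_coef; simpl.
    rewrite Nat.add_0_r, Nat.add_1_r; field; lra.
  - simpl sum_f_R0; rewrite IH, laguerre_functional_three_term by exact Hb.
    rewrite !S_INR; ring.
Qed.

(** The integral of u^(b-1) A (u^j exp (-lam u^r)) is 0 because A is symmetric and A 1 = 0; on
    moments, this is the recurrence applied twice. For j = 0 the term in [pred j] carries the factor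
    0. *)
Lemma moment_lower_0 (b lam : R) (r : nat) (m : nat -> R) (j : nat) :
  (1 <= r)%nat ->
  (forall n, lam * INR r * m (n + r)%nat = (b + INR n) * m n) ->
  INR j * (INR j + b - 1) * m (pred j)
  - lam * INR r * (2 * INR j + b + INR r - 1) * m (j + r - 1)%nat
  + (lam * INR r) ^ 2 * m (j + 2 * r - 1)%nat = 0.
Proof.
  intros Hr Hm; destruct j as [|j].
  - replace (0 + 2 * r - 1)%nat with ((r - 1) + r)%nat by lia.
    replace (0 + r - 1)%nat with (r - 1)%nat by lia.
    transitivity ((lam * INR r) *
      ((lam * INR r) * m (r - 1 + r)%nat - (b + INR (r - 1)) * m (r - 1)%nat)).
    + rewrite minus_INR by lia; simpl INR; ring.
    + rewrite Hm; ring.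
  - simpl pred.
    replace (S j + 2 * r - 1)%nat with ((j + r) + r)%nat by lia.
    replace (S j + r - 1)%nat with (j + r)%nat by lia.
    transitivity (INR (S j) * (INR (S j) + b - 1) * m j
      - (2 * INR (S j) + b + INR r - 1) * (lam * INR r * m (j + r)%nat)
      + lam * INR r * (lam * INR r * m (j + r + r)%nat)); [ring|].
    replace (lam * INR r * (lam * INR r * m (j + r + r)%nat))
      with ((b + INR (j + r)) * (lam * INR r * m (j + r)%nat)) by (rewrite (Hm (j + r)%nat); ring).
    rewrite Hm, S_INR, plus_INR; ring.
Qed.

(* The operator [u D^2 + b D] lowers the index of Laguerre polynomials and is
   symmetric for the weight [u^(b-1)]; the right-hand side is its action on
   [u^j exp (-lam u^r)]. *)
Lemma laguerre_functional_lower (b lam : R) (r : nat) (m : nat -> R) (k j : nat) :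
  0 < b -> (1 <= r)%nat ->
  (forall n, lam * INR r * m (n + r)%nat = (b + INR n) * m n) ->
  - (INR k + b) * laguerre_functional b m k j =
  INR j * (INR j + b - 1) * laguerre_functional b m (S k) (pred j)
  - lam * INR r * (2 * INR j + b + INR r - 1) * laguerre_functional b m (S k) (j + r - 1)
  + (lam * INR r) ^ 2 * laguerre_functional b m (S k) (j + 2 * r - 1).
Proof.
  intros Hb Hr Hm.
  rewrite (Rmult_comm (- (INR k + b))).
  unfold laguerre_functional.
  rewrite !(scal_sum _ (S k)), <- minus_sum, <- plus_sum, (sum_f_R0_shift _ k).
  rewrite (Rmult_comm _ (- (INR k + b))), scal_sum.
  rewrite <- (Rplus_0_l (sum_f_R0 _ k)); f_equal.
  - rewrite !Nat.add_0_r; symmetry.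
    transitivity (laguerre_coef b (S k) 0 *
      (INR j * (INR j + b - 1) * m (pred j)
       - lam * INR r * (2 * INR j + b + INR r - 1) * m (j + r - 1)%nat
       + (lam * INR r) ^ 2 * m (j + 2 * r - 1)%nat)); [ring|].
    rewrite moment_lower_0 by assumption; ring.
  - apply sum_eq; intros l _.
    transitivity (laguerre_coef b (S k) (S l) * (INR (S l) * (INR l + b)) * m (j + l)%nat).
    { rewrite laguerre_coef_lower by exact Hb; ring. }
    replace (j + 2 * r - 1 + S l)%nat with ((j + l + r) + r)%nat by lia.
    replace (j + r - 1 + S l)%nat with (j + l + r)%nat by lia.
    transitivity (laguerre_coef b (S k) (S l) *
        (INR j * (INR j + b - 1) * m (j + l)%nat
        - (2 * INR j + b + INR r - 1) * (lam * INR r * m (j + l + r)%nat)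
        + lam * INR r * (lam * INR r * m (j + l + r + r)%nat))).
    + replace (lam * INR r * (lam * INR r * m (j + l + r + r)%nat))
        with ((b + INR (j + l + r)) * (lam * INR r * m (j + l + r)%nat))
        by (rewrite (Hm (j + l + r)%nat); ring).
      rewrite Hm, S_INR, !plus_INR; ring.
    + destruct j as [|j]; [simpl INR; ring|].
      replace (pred (S j) + S l)%nat with (S j + l)%nat by lia; ring.
Qed.

(** * Integrals of Laguerre polynomials *)

Definition weighted_integral (b : R) (f : R -> R) (v : R) : Prop :=
  is_RInt_gen (fun u => Rpower u (b - 1) * f u) (at_right 0) (Rbar_locally p_infty) v.

Lemma filter_prod_pos_le :
  filter_prod (at_right 0) (Rbar_locally p_infty) (fun ab : R * R => 0 < fst ab <= snd ab).
Proof.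
  apply Filter_prod with (Q := fun x => 0 < x < 1) (R := fun x => 1 < x).
  - exists posreal_one; intros y Hy Hy0.
    change (Rabs (y - 0) < 1) in Hy; apply Rabs_def2 in Hy; lra.
  - exists 1; intros y Hy; exact Hy.
  - intros x y Hx Hy; simpl; lra.
Qed.

Lemma weighted_integral_ext (b : R) (f g : R -> R) (v w : R) :
  (forall u, 0 < u -> f u = g u) -> v = w ->
  weighted_integral b f v -> weighted_integral b g w.
Proof.
  intros Hfg <- Hf; eapply is_RInt_gen_ext; [|exact Hf].
  generalize filter_prod_pos_le; apply filter_imp; intros [x y] Hxy u [Hu _]; simpl in *.
  rewrite Rmin_left in Hu by lra; rewrite Hfg by lra; easy.
Qed.

Lemma weighted_integral_plus (b : R) (f g : R -> R) (v w : R) :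
  weighted_integral b f v -> weighted_integral b g w ->
  weighted_integral b (fun u => f u + g u) (v + w).
Proof.
  intros Hf Hg; eapply is_RInt_gen_ext; [|exact (is_RInt_gen_plus _ _ _ _ Hf Hg)].
  apply filter_forall; intros ab u _.
  unfold plus; simpl; ring.
Qed.

Lemma weighted_integral_scal (b k : R) (f : R -> R) (v : R) :
  weighted_integral b f v -> weighted_integral b (fun u => k * f u) (k * v).
Proof.
  intros Hf; eapply is_RInt_gen_ext; [|exact (is_RInt_gen_scal _ k _ Hf)].
  apply filter_forall; intros ab u _.
  unfold scal, mult; simpl; unfold mult; simpl; ring.
Qed.

Lemma weighted_integral_minus (b : R) (f g : R -> R) (v w : R) :
  weighted_integral b f v -> weighted_integral b g w ->
  weighted_integral b (fun u => f u - g u) (v - w).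
Proof.
  intros Hf Hg.
  eapply weighted_integral_ext;
    [| |exact (weighted_integral_plus _ _ _ _ _ Hf (weighted_integral_scal _ (-1) _ _ Hg))].
  - intros u _; cbv beta; ring.
  - ring.
Qed.

Lemma weighted_integral_sum (b : R) (f : nat -> R -> R) (v : nat -> R) (n : nat) :
  (forall k, (k <= n)%nat -> weighted_integral b (f k) (v k)) ->
  weighted_integral b (fun u => sum_f_R0 (fun k => f k u) n) (sum_f_R0 v n).
Proof.
  induction n as [|n IH]; intros H; simpl; [now apply H|].
  apply weighted_integral_plus; [apply IH; intros; apply H; lia | now apply H].
Qed.

Lemma weighted_integral_abs_le (b : R) (f g : R -> R) (v w : R) :
  (forall u, 0 < u -> Rabs (f u) <= g u) ->
  weighted_integral b f v -> weighted_integral b g w -> Rabs v <= w.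
Proof.
  intros Hfg Hf Hg.
  apply (RInt_gen_norm (Fa := at_right 0) (Fb := Rbar_locally p_infty)
    (fun u => Rpower u (b - 1) * f u) (fun u => Rpower u (b - 1) * g u) v w);
    try assumption.
  - generalize filter_prod_pos_le; apply filter_imp; intros [x y] Hxy; simpl in *; lra.
  - generalize filter_prod_pos_le; apply filter_imp; intros [x y] Hxy u Hu; simpl in *.
    change (Rabs (Rpower u (b - 1) * f u) <= Rpower u (b - 1) * g u).
    rewrite Rabs_mult, Rabs_right by (left; apply exp_pos).
    apply Rmult_le_compat_l; [left; apply exp_pos | apply Hfg; lra].
Qed.

Lemma weighted_integral_le (b : R) (f g : R -> R) (v w : R) :
  (forall u, 0 < u -> f u <= g u) ->
  weighted_integral b f v -> weighted_integral b g w -> v <= w.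
Proof.
  intros Hfg Hf Hg.
  pose proof (weighted_integral_minus _ _ _ _ _ Hg Hf) as Hd.
  (* The order relation comes from the norm inequality; the zero function is taken as a multiple of
     f so that its integral is at hand. *)
  assert (Rabs (0 * v) <= w - v); [|rewrite Rmult_0_l, Rabs_R0 in *; lra].
  apply (weighted_integral_abs_le b (fun u => 0 * f u) (fun u => g u - f u));
    [|now apply weighted_integral_scal | exact Hd].
  intros u Hu; rewrite Rmult_0_l, Rabs_R0; specialize (Hfg u Hu); lra.
Qed.

Definition moment (b lam : R) (r j : nat) : R :=
  Rpower lam (- ((b + INR j) / INR r)) * Gamma ((b + INR j) / INR r) / INR r.

Lemma weighted_integral_moment (b lam : R) (r j : nat) :
  0 < b -> 0 < lam -> (1 <= r)%nat ->
  weighted_integral b (fun u => u ^ j * exp (- (lam * u ^ r))) (moment b lam r j).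
Proof.
  intros Hb Hlam Hr.
  pose proof (pos_INR j).
  assert (Hbj : 0 < b + INR j) by lra.
  eapply is_RInt_gen_ext; [|exact (is_RInt_gen_Rpower_exp_pow (b + INR j) lam r Hbj Hlam Hr)].
  generalize filter_prod_pos_le; apply filter_imp; intros [x y] Hxy u [Hu _]; simpl in *.
  rewrite Rmin_left in Hu by lra.
  rewrite <- (Rpower_pow j u) by lra.
  replace (b + INR j - 1) with (b - 1 + INR j) by ring.
  rewrite Rpower_plus; ring.
Qed.

(** The functional equation of Gamma, in the form that [moment_lower_0] and
    [laguerre_functional_lower] assume of a moment sequence. *)
Lemma moment_shift (b lam : R) (r n : nat) :
  0 < b -> 0 < lam -> (1 <= r)%nat ->
  lam * INR r * moment b lam r (n + r) = (b + INR n) * moment b lam r n.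
Proof.
  intros Hb Hlam Hr; unfold moment.
  assert (HrR : 1 <= INR r) by (apply (le_INR 1); exact Hr).
  pose proof (pos_INR n).
  rewrite plus_INR.
  replace ((b + (INR n + INR r)) / INR r) with ((b + INR n) / INR r + 1) by (field; lra).
  assert (0 < (b + INR n) / INR r) by (apply Rdiv_lt_0_compat; lra).
  rewrite Gamma_S by assumption.
  replace (- ((b + INR n) / INR r + 1)) with (- ((b + INR n) / INR r) + - (1)) by ring.
  rewrite Rpower_plus, (Rpower_Ropp lam 1), Rpower_1 by assumption.
  field; lra.
Qed.

Lemma weighted_integral_exp (b s : R) (j : nat) :
  0 < b -> 0 < s ->
  weighted_integral b (fun u => u ^ j * exp (- (s * u)))
    (Gamma b * poch b j * Rpower s (- (b + INR j))).
Proof.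
  intros Hb Hs.
  eapply weighted_integral_ext; [| |apply (weighted_integral_moment b s 1 j Hb Hs (le_n 1))].
  - intros u _; cbv beta; rewrite pow_1; easy.
  - unfold moment; change (INR 1) with 1.
    rewrite !Rdiv_1_r, Gamma_add by exact Hb; ring.
Qed.

Definition laguerre (b : R) (k : nat) (u : R) : R :=
  sum_f_R0 (fun l => laguerre_coef b k l * u ^ l) k.

Lemma weighted_integral_mult_laguerre (b : R) (g : R -> R) (m : nat -> R) (k j : nat) :
  (forall l, (l <= k)%nat -> weighted_integral b (fun u => u ^ (j + l) * g u) (m (j + l)%nat)) ->
  weighted_integral b (fun u => u ^ j * g u * laguerre b k u) (laguerre_functional b m k j).
Proof.
  intros H.
  eapply weighted_integral_ext; [|reflexivity|
    apply (weighted_integral_sum b (fun l u => laguerre_coef b k l * (u ^ (j + l) * g u))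
             (fun l => laguerre_coef b k l * m (j + l)%nat) k)].
  - intros u _; cbv beta; unfold laguerre; rewrite scal_sum.
    apply sum_eq; intros l _; rewrite pow_add; ring.
  - intros l Hl; now apply weighted_integral_scal, H.
Qed.

(** Chu-Vandermonde with y = b + m gives (b - y)_k = (-m)_k, which is 0 for m < k: this is the
    orthogonality of L_k to lower powers. *)
Lemma weighted_integral_laguerre_pow (b : R) (k m : nat) :
  0 < b ->
  weighted_integral b (fun u => u ^ m * exp (- u) * laguerre b k u)
    (Gamma b * poch b m * poch (- INR m) k / INR (fact k)).
Proof.
  intros Hb.
  eapply weighted_integral_ext; [| |
    apply (weighted_integral_mult_laguerre b (fun u => exp (- (1 * u)))
             (fun n => Gamma b * poch b n) k m)].
  - intros u _; cbv beta; rewrite Rmult_1_l; easy.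
  - unfold laguerre_functional.
    rewrite (sum_eq _ (fun l => poch (- INR k) l * poch (b + INR m) l / (INR (fact l) * poch b l)
       * (Gamma b * poch b m * poch b k / INR (fact k)))).
    + rewrite <- scal_sum, chu_vandermonde by exact Hb.
      replace (b - (b + INR m)) with (- INR m) by ring.
      pose proof (poch_pos b k Hb); pose proof (INR_fact_lt_0 k); field; lra.
    + intros l _; unfold laguerre_coef; rewrite poch_add.
      pose proof (poch_pos b l Hb); pose proof (INR_fact_lt_0 k); pose proof (INR_fact_lt_0 l).
      field; lra.
  - intros l _.
    eapply weighted_integral_ext; [reflexivity| |apply (weighted_integral_exp b 1); lra].
    unfold Rpower; rewrite ln_1, Rmult_0_r, exp_0; ring.
Qed.

(** Expanding the factor of lower index leaves only the power m = k, present when l = k. Its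
    coefficient has the sign (-1)^k, as does (-k)_k, and the signs cancel. *)
Lemma weighted_integral_laguerre_laguerre (b : R) (k l : nat) :
  0 < b -> (l <= k)%nat ->
  weighted_integral b (fun u => laguerre b l u * laguerre b k u * exp (- u))
    (if Nat.eq_dec l k then Gamma b * poch b k / INR (fact k) else 0).
Proof.
  intros Hb Hl.
  eapply weighted_integral_ext; [| |
    apply (weighted_integral_sum b
      (fun m u => laguerre_coef b l m * (u ^ m * exp (- u) * laguerre b k u))
      (fun m => laguerre_coef b l m * (Gamma b * poch b m * poch (- INR m) k / INR (fact k))) l)].
  - intros u _; cbv beta; unfold laguerre at 2; rewrite Rmult_assoc, (Rmult_comm (sum_f_R0 _ l)), scal_sum.
    apply sum_eq; intros m _; ring.
  - assert (Hz : forall m, (m < k)%nat ->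
      laguerre_coef b l m * (Gamma b * poch b m * poch (- INR m) k / INR (fact k)) = 0)
      by (intros m Hm; rewrite poch_opp_INR_0 by exact Hm; unfold Rdiv; ring).
    destruct (Nat.eq_dec l k) as [->|Hne].
    + transitivity (laguerre_coef b k k * (Gamma b * poch b k * poch (- INR k) k / INR (fact k))).
      * destruct k as [|k]; [easy|].
        rewrite tech5, (sum_eq _ (fun _ => 0)), sum_cte by (intros; apply Hz; lia).
        ring.
      * unfold laguerre_coef; rewrite poch_opp_INR_diag.
        pose proof (poch_pos b k Hb); pose proof (INR_fact_lt_0 k).
        transitivity (((-1) ^ k * (-1) ^ k) * (Gamma b * poch b k / INR (fact k))); [field; lra|].
        rewrite <- Rpow_mult_distr; replace (-1 * -1) with 1 by ring; rewrite pow1; ring.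
    + rewrite (sum_eq _ (fun _ => 0)), sum_cte by (intros; apply Hz; lia); ring.
  - intros m _; now apply weighted_integral_scal, weighted_integral_laguerre_pow.
Qed.

Lemma pow_add_1_ge (u : R) (r : nat) : 0 < u -> (1 <= r)%nat -> u <= 1 + u ^ r.
Proof.
  intros Hu Hr; pose proof (pow_lt u r Hu).
  destruct (Rle_lt_dec u 1) as [H1|H1]; [lra|].
  assert (u ^ 1 <= u ^ r) by (apply Rle_pow; [lra | exact Hr]).
  rewrite pow_1 in *; lra.
Qed.

(* [u <= 1 + lam u^r] makes [exp (u/2)] harmless, so AM-GM applies to
   [(X exp (u/2)) * (Y exp (-u/2))]. *)
Lemma exp_pow_mult_le (lam X Y u eps : R) (r : nat) :
  1 <= lam -> (1 <= r)%nat -> 0 < u -> 0 < eps ->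
  X * exp (- (lam * u ^ r)) * Y <=
  / 2 * (eps * exp 1 * (X ^ 2 * exp (- (lam * u ^ r)))) + / (2 * eps) * (Y ^ 2 * exp (- u)).
Proof.
  intros Hlam Hr Hu Heps.
  set (p := exp (- (lam * u ^ r))); set (q := exp (- u)).
  assert (Hp : 0 < p) by apply exp_pos; assert (Hq : 0 < q) by apply exp_pos.
  assert (Hpq : p <= exp 1 * q).
  { unfold p, q; rewrite <- exp_plus.
    pose proof (pow_add_1_ge u r Hu Hr); pose proof (pow_lt u r Hu).
    assert (- (lam * u ^ r) <= 1 + - u) as [Hl| ->] by nra; [|lra].
    left; now apply exp_increasing. }
  apply Rle_trans with (/ 2 * (eps * exp 1 * (X ^ 2 * p)) + / (2 * eps) * (Y ^ 2 * (p * / exp 1))).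
  - pose proof (exp_pos 1) as He.
    (* The square behind AM-GM, with the factor e lost in p <= e q already built in. *)
    assert (0 <= p * (eps * exp 1 * X - Y) ^ 2 * (/ (2 * eps * exp 1))) as Hs.
    { apply Rmult_le_pos; [apply Rmult_le_pos; [lra | apply pow2_ge_0]|].
      left; apply Rinv_0_lt_compat; repeat apply Rmult_lt_0_compat; lra. }
    replace (p * (eps * exp 1 * X - Y) ^ 2 * / (2 * eps * exp 1)) with
      (/ 2 * (eps * exp 1 * (X ^ 2 * p)) + / (2 * eps) * (Y ^ 2 * (p * / exp 1)) - X * p * Y)
      in Hs by (field; lra).
    lra.
  - apply Rplus_le_compat_l, Rmult_le_compat_l.
    + left; apply Rinv_0_lt_compat; lra.
    + apply Rmult_le_compat_l; [apply pow2_ge_0|].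
      pose proof (exp_pos 1).
      apply (Rmult_le_reg_r (exp 1)); [assumption|].
      rewrite Rmult_assoc, Rinv_l by lra; lra.
Qed.

Lemma weighted_integral_moment_laguerre (b lam : R) (r k j : nat) :
  0 < b -> 0 < lam -> (1 <= r)%nat ->
  weighted_integral b (fun u => u ^ j * exp (- (lam * u ^ r)) * laguerre b k u)
    (laguerre_functional b (moment b lam r) k j).
Proof.
  intros Hb Hlam Hr.
  apply weighted_integral_mult_laguerre; intros l _.
  now apply weighted_integral_moment.
Qed.

(** AM-GM with eps = 1, X = u^j and Y = L_k or -L_k. The first term is a fixed moment, the second
    half the squared norm of L_k, so the bound grows polynomially in k; it starts the induction for
    rapid decay. *)
Lemma laguerre_functional_bound (b lam : R) (r k j : nat) :
  0 < b -> 1 <= lam -> (1 <= r)%nat ->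
  Rabs (laguerre_functional b (moment b lam r) k j) <=
  / 2 * (1 * exp 1 * moment b lam r (j * 2)) + / (2 * 1) * (Gamma b * poch b k / INR (fact k)).
Proof.
  intros Hb Hlam Hr.
  apply (weighted_integral_abs_le b
    (fun u => u ^ j * exp (- (lam * u ^ r)) * laguerre b k u)
    (fun u => / 2 * (1 * exp 1 * (u ^ (j * 2) * exp (- (lam * u ^ r))))
              + / (2 * 1) * (laguerre b k u * laguerre b k u * exp (- u)))).
  - intros u Hu; rewrite pow_mult.
    apply Rabs_le; split.
    + apply Ropp_le_cancel; rewrite Ropp_involutive.
      generalize (exp_pow_mult_le lam (u ^ j) (- laguerre b k u) u 1 r Hlam Hr Hu Rlt_0_1).
      replace ((- laguerre b k u) ^ 2) with (laguerre b k u * laguerre b k u) by ring.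
      lra.
    + generalize (exp_pow_mult_le lam (u ^ j) (laguerre b k u) u 1 r Hlam Hr Hu Rlt_0_1).
      replace ((laguerre b k u) ^ 2) with (laguerre b k u * laguerre b k u) by ring.
      lra.
  - apply weighted_integral_moment_laguerre; lra || assumption.
  - apply weighted_integral_plus.
    + apply weighted_integral_scal, weighted_integral_scal.
      apply weighted_integral_moment; lra || assumption.
    + apply weighted_integral_scal.
      generalize (weighted_integral_laguerre_laguerre b k k Hb (le_n k)).
      destruct (Nat.eq_dec k k); easy.
Qed.

(** * The Laguerre generating function *)

Lemma binomial_poch (k : nat) (y : R) :
  sum_f_R0 (fun l => poch (- INR k) l / INR (fact l) * y ^ l) k = (1 - y) ^ k.
Proof.
  induction k as [|k IH]; [simpl; field|].
  rewrite sum_f_R0_shift.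
  rewrite (sum_eq _ (fun l => poch (- INR k) (S l) / INR (fact (S l)) * y ^ S l
                              + poch (- INR k) l / INR (fact l) * y ^ l * (- y))).
  - rewrite plus_sum, <- scal_sum, IH, <- Rplus_assoc.
    transitivity (sum_f_R0 (fun l => poch (- INR k) l / INR (fact l) * y ^ l) (S k)
                  + - y * (1 - y) ^ k).
    + rewrite sum_f_R0_shift; easy.
    + rewrite (sum_f_R0_extend _ k (S k)), IH; [simpl; ring | lia |].
      intros l Hl; rewrite poch_opp_INR_0 by lia; unfold Rdiv; ring.
  - intros l _; rewrite poch_opp_pascal, fact_simpl, mult_INR.
    pose proof (INR_fact_lt_0 l); pose proof (pos_INR l); rewrite S_INR; simpl pow; field; lra.
Qed.

(** Closed form of sum_k t^k L_k(u). The identity enters in mean square, through the Laguerre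
    coefficients and the norm computed next. *)
Definition laguerre_gf (b t u : R) : R := Rpower (1 - t) (- b) * exp (- (t / (1 - t) * u)).

(** Times e^(-u) the exponential becomes e^(-u/(1-t)), whose moments turn the sum over l into (1 -
    (1-t))^k. *)
Lemma weighted_integral_gf_laguerre (b t : R) (k : nat) :
  0 < b -> 0 < t < 1 ->
  weighted_integral b (fun u => laguerre_gf b t u * laguerre b k u * exp (- u))
    (Gamma b * poch b k / INR (fact k) * t ^ k).
Proof.
  intros Hb Ht.
  eapply weighted_integral_ext; [| |
    apply (weighted_integral_scal b (Rpower (1 - t) (- b))
       (fun u => u ^ 0 * exp (- (/ (1 - t) * u)) * laguerre b k u)),
    (weighted_integral_mult_laguerre b _
       (fun n => Gamma b * poch b n * Rpower (1 - t) (b + INR n)) k 0)].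
  - intros u _; cbv beta; unfold laguerre_gf.
    replace (- (/ (1 - t) * u)) with (- (t / (1 - t) * u) + - u) by (field; lra).
    rewrite exp_plus; simpl; ring.
  - unfold laguerre_functional; rewrite scal_sum.
    replace (t ^ k) with ((1 - (1 - t)) ^ k) by (f_equal; ring).
    rewrite <- binomial_poch, scal_sum.
    apply sum_eq; intros l _; unfold laguerre_coef; rewrite Nat.add_0_l.
    rewrite Rpower_plus, Rpower_pow, Rpower_Ropp by lra.
    assert (0 < Rpower (1 - t) b) by apply exp_pos.
    pose proof (poch_pos b l Hb); pose proof (INR_fact_lt_0 k); pose proof (INR_fact_lt_0 l).
    field; lra.
  - intros l _.
    assert (0 < / (1 - t)) by (apply Rinv_0_lt_compat; lra).
    eapply weighted_integral_ext; [reflexivity | | apply weighted_integral_exp; assumption].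
    f_equal; unfold Rpower; rewrite ln_Rinv by lra; f_equal; simpl; ring.
Qed.

Lemma weighted_integral_gf_sqr (b t : R) :
  0 < b -> 0 < t < 1 ->
  weighted_integral b (fun u => laguerre_gf b t u ^ 2 * exp (- u))
    (Gamma b * Rpower (1 - t ^ 2) (- b)).
Proof.
  intros Hb Ht.
  assert (Hs : 0 < (1 + t) * / (1 - t))
    by (apply Rmult_lt_0_compat; [lra | apply Rinv_0_lt_compat; lra]).
  eapply weighted_integral_ext; [| |
    apply (weighted_integral_scal b (Rpower (1 - t) (- b) ^ 2)), (weighted_integral_exp b _ 0 Hb Hs)].
  - intros u _; cbv beta; unfold laguerre_gf.
    replace (- ((1 + t) * / (1 - t) * u)) with
      (- (t / (1 - t) * u) + (- (t / (1 - t) * u) + - u)) by (field; lra).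
    rewrite !exp_plus; simpl; ring.
  - simpl poch; change (INR 0) with 0; rewrite Rplus_0_r.
    replace (1 - t ^ 2) with ((1 + t) * (1 - t)) by ring.
    assert (0 < / (1 - t)) by (apply Rinv_0_lt_compat; lra).
    rewrite <- !Rpower_mult_distr by lra.
    replace (Rpower (/ (1 - t)) (- b)) with (/ Rpower (1 - t) (- b))
      by (unfold Rpower; rewrite ln_Rinv by lra; rewrite <- exp_Ropp; f_equal; ring).
    assert (0 < Rpower (1 - t) (- b)) by apply exp_pos.
    field; lra.
Qed.

(** Here the factor e^(-u) is absent, and 1 - lam u^r is a minorant of exp (-lam u^r) with an
    explicit integral. As t -> 1 the value tends to Gamma(b), since the mass concentrates at 0; this
    is the source of positivity. *)
Lemma weighted_integral_gf_lower (b lam t : R) (r : nat) :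
  0 < b -> 0 < t < 1 ->
  weighted_integral b (fun u => (1 - lam * u ^ r) * laguerre_gf b t u)
    (Gamma b * Rpower t (- b) * (1 - lam * poch b r * ((1 - t) / t) ^ r)).
Proof.
  intros Hb Ht.
  assert (Hi : 0 < / (1 - t)) by (apply Rinv_0_lt_compat; lra).
  assert (Hs : 0 < t * / (1 - t)) by (apply Rmult_lt_0_compat; lra).
  eapply weighted_integral_ext; [| |
    exact (weighted_integral_scal b (Rpower (1 - t) (- b)) _ _
      (weighted_integral_minus b _ _ _ _ (weighted_integral_exp b _ 0 Hb Hs)
        (weighted_integral_scal b lam _ _ (weighted_integral_exp b _ r Hb Hs))))].
  - intros u _; cbv beta; unfold laguerre_gf; simpl pow; unfold Rdiv; ring.
  - simpl poch; change (INR 0) with 0; rewrite Rplus_0_r, !Ropp_plus_distr, !Rpower_plus.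
    rewrite <- !Rpower_mult_distr by lra.
    rewrite !(Rpower_Ropp _ (INR r)), !Rpower_pow by lra.
    replace (Rpower (/ (1 - t)) (- b)) with (/ Rpower (1 - t) (- b))
      by (unfold Rpower; rewrite ln_Rinv by lra; rewrite <- exp_Ropp; f_equal; ring).
    assert (0 < Rpower (1 - t) (- b)) by apply exp_pos.
    assert (0 < t ^ r) by (apply pow_lt; lra); assert (0 < (1 - t) ^ r) by (apply pow_lt; lra).
    unfold Rdiv; rewrite Rpow_mult_distr, !pow_inv; field; lra.
Qed.

(** * Rapid decay *)

(** The sum F satisfies (1 - y) F' = b F, so F (1 - y)^b is constant. With y = t^2 this is
    Parseval's identity for [laguerre_gf]. *)
Lemma is_series_poch_binomial (b y : R) :
  0 < b -> 0 <= y < 1 ->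
  is_series (fun k => poch b k / INR (fact k) * y ^ k) (Rpower (1 - y) (- b)).
Proof.
  intros Hb Hy.
  set (a := fun k => poch b k / INR (fact k)).
  assert (Ha : forall n, 0 < a n)
    by (intros n; apply Rdiv_lt_0_compat; [now apply poch_pos | apply INR_fact_lt_0]).
  assert (HaS : forall n, INR (S n) * a (S n) = (b + INR n) * a n).
  { intros n; unfold a; rewrite fact_simpl, mult_INR, S_INR; simpl poch.
    pose proof (INR_fact_lt_0 n); pose proof (pos_INR n); field; lra. }
  assert (Hcv : CV_radius a = 1).
  { rewrite <- (Rinv_1) at 1; apply CV_radius_finite_DAlembert.
    - intros n; specialize (Ha n); lra.
    - lra.
    - apply is_lim_seq_ext with (fun n => 1 + (b - 1) * / INR (S n)).
      + intros n; pose proof (pos_INR n).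
        replace (a (S n) / a n) with ((b + INR n) / (INR n + 1)).
        * rewrite Rabs_right by (apply Rle_ge, Rlt_le, Rdiv_lt_0_compat; lra).
          rewrite S_INR; field; lra.
        * specialize (HaS n); rewrite S_INR in HaS; specialize (Ha n).
          apply (Rmult_eq_reg_r ((INR n + 1) * a n)); [field_simplify; lra | nra].
      + replace (Finite 1) with (Finite (1 + (b - 1) * 0)) by (f_equal; ring).
        apply is_lim_seq_plus'; [apply is_lim_seq_const|].
        apply (is_lim_seq_scal_l _ (b - 1) 0).
        apply (is_lim_seq_incr_1 (fun n => / INR n)).
        apply (is_lim_seq_inv INR p_infty is_lim_seq_INR); easy. }
  assert (Hin : forall x, 0 <= x <= y -> Rbar_lt (Rabs x) (CV_radius a))
    by (intros x Hx; rewrite Hcv, Rabs_right by lra; simpl; lra).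
  assert (HF : PSeries a y * Rpower (1 - y) b = 1).
  { destruct (Req_dec y 0) as [->|Hy0].
    { rewrite PSeries_0, Rminus_0_r; unfold Rpower, a; rewrite ln_1, Rmult_0_r, exp_0; simpl; field. }
    rewrite <- (eq_is_derive (fun x => PSeries a x * Rpower (1 - x) b) 0 y).
    - rewrite PSeries_0, Rminus_0_r; unfold Rpower, a; rewrite ln_1, Rmult_0_r, exp_0; simpl; field.
    - intros x Hx.
      assert (Hode : PSeries (PS_derive a) x = b * PSeries a x + x * PSeries (PS_derive a) x).
      { rewrite <- PSeries_incr_1, <- PSeries_scal, <- PSeries_plus.
        - apply PSeries_ext; intros n; unfold PS_derive, PS_plus, PS_scal, plus, scal; simpl.
          unfold mult; simpl; destruct n as [|n].
          + generalize (HaS 0%nat); simpl; unfold zero; simpl; lra.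
          + change (INR (S (S n)) * a (S (S n)) = b * a (S n) + INR (S n) * a (S n)).
            rewrite HaS; ring.
        - apply ex_pseries_scal; [apply Rmult_comm | now apply CV_radius_inside, Hin].
        - apply ex_pseries_incr_1, CV_radius_inside; rewrite CV_radius_derive; now apply Hin. }
      replace (@zero R_NormedModule) with
        (PSeries (PS_derive a) x * Rpower (1 - x) b + PSeries a x * ((-1) * (b * Rpower (1 - x) (b - 1)))).
      + apply (is_derive_mult (PSeries a) (fun v => Rpower (1 - v) b)).
        * now apply is_derive_PSeries, Hin.
        * apply (is_derive_comp (fun v => Rpower v b) (fun v => 1 - v)).
          -- apply is_derive_Rpower; lra.
          -- auto_derive; [easy | ring].
        * intros; apply Rmult_comm.
      + replace (Rpower (1 - x) b) with ((1 - x) * Rpower (1 - x) (b - 1)).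
        * change (@zero R_NormedModule) with 0.
          transitivity ((PSeries (PS_derive a) x - (b * PSeries a x + x * PSeries (PS_derive a) x))
                        * Rpower (1 - x) (b - 1)); [ring|].
          rewrite <- Hode; ring.
        * rewrite <- (Rpower_1 (1 - x)) at 1 by lra.
          rewrite <- Rpower_plus; f_equal; ring.
    - lra. }
  rewrite Rpower_Ropp.
  assert (Hp : 0 < Rpower (1 - y) b) by apply exp_pos.
  replace (/ Rpower (1 - y) b) with (PSeries a y)
    by (apply (Rmult_eq_reg_r (Rpower (1 - y) b)); [rewrite HF; field; lra | lra]).
  assert (Hex : ex_pseries a y) by (apply CV_radius_inside, Hin; lra).
  apply is_series_ext with (fun k => scal (pow_n y k) (a k)).
  - intros n; rewrite pow_n_pow; apply Rmult_comm.
  - now apply PSeries_correct.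
Qed.

(** The ratio of consecutive terms is 1 + (b-1)/(k+1), at most 1 + N/(k+1), hence at most (1 +
    1/(k+1))^N by Bernoulli. *)
Lemma poch_div_fact_le (b : R) (N k : nat) :
  0 < b -> b <= INR N -> (1 <= N)%nat -> poch b k / INR (fact k) <= (INR k + 1) ^ N.
Proof.
  intros Hb HbN HN; induction k as [|k IH].
  - simpl; rewrite Rplus_0_l, pow1; lra.
  - pose proof (pos_INR k) as Hk; pose proof (INR_fact_lt_0 k) as Hf.
    replace (poch b (S k) / INR (fact (S k))) with
      (poch b k / INR (fact k) * ((b + INR k) / (INR k + 1)))
      by (rewrite fact_simpl, mult_INR, S_INR; simpl poch; field; lra).
    rewrite S_INR.
    assert (Hinv : 0 < / (INR k + 1)) by (apply Rinv_0_lt_compat; lra).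
    apply Rle_trans with ((INR k + 1) ^ N * (1 + / (INR k + 1)) ^ N).
    + apply Rmult_le_compat; [| |exact IH|].
      * apply Rlt_le, Rdiv_lt_0_compat; [now apply poch_pos | exact Hf].
      * apply Rlt_le, Rdiv_lt_0_compat; lra.
      * apply Rle_trans with (1 + INR N * / (INR k + 1)); [|now apply poly].
        replace ((b + INR k) / (INR k + 1)) with (1 + (b - 1) * / (INR k + 1)) by (field; lra).
        apply Rplus_le_compat_l, Rmult_le_compat_r; lra.
    + rewrite <- Rpow_mult_distr; right; f_equal; field; lra.
Qed.

Definition rapidly_decreasing (c : nat -> R) : Prop :=
  forall q, exists K, forall k, Rabs (c k) * (INR k + 1) ^ q <= K.

Definition poly_growth (p : nat -> R) : Prop :=
  exists B d, 0 <= B /\ forall k, Rabs (p k) <= B * (INR k + 1) ^ d.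

Lemma poly_growth_const (x : R) : poly_growth (fun _ => x).
Proof. exists (Rabs x), 0%nat; split; [apply Rabs_pos | intros; simpl; lra]. Qed.

Lemma poly_growth_INR : poly_growth INR.
Proof.
  exists 1, 1%nat; split; [lra|]; intros k; pose proof (pos_INR k).
  rewrite Rabs_right by lra; lra.
Qed.

Lemma poly_growth_mult (p q : nat -> R) :
  poly_growth p -> poly_growth q -> poly_growth (fun k => p k * q k).
Proof.
  intros (B & d & HB & Hp) (B' & d' & HB' & Hq).
  exists (B * B'), (d + d')%nat; split; [now apply Rmult_le_pos|]; intros k.
  rewrite Rabs_mult, pow_add.
  replace (B * B' * ((INR k + 1) ^ d * (INR k + 1) ^ d'))
    with ((B * (INR k + 1) ^ d) * (B' * (INR k + 1) ^ d')) by ring.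
  apply Rmult_le_compat; auto using Rabs_pos.
Qed.

Lemma poly_growth_plus (p q : nat -> R) :
  poly_growth p -> poly_growth q -> poly_growth (fun k => p k + q k).
Proof.
  intros (B & d & HB & Hp) (B' & d' & HB' & Hq).
  exists (B + B'), (d + d')%nat; split; [lra|]; intros k.
  assert (H1 : 1 <= INR k + 1) by (pose proof (pos_INR k); lra).
  eapply Rle_trans; [apply Rabs_triang|]; rewrite Rmult_plus_distr_r.
  apply Rplus_le_compat; (eapply Rle_trans; [auto|]); apply Rmult_le_compat_l; try assumption;
    apply Rle_pow; lia || assumption.
Qed.

Lemma poly_growth_ext (p q : nat -> R) : (forall k, p k = q k) -> poly_growth p -> poly_growth q.
Proof.
  intros H (B & d & HB & Hp); exists B, d; split; [easy|]; intros k; rewrite <- H; auto.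
Qed.

Lemma rapidly_decreasing_mult (p c : nat -> R) :
  poly_growth p -> rapidly_decreasing c -> rapidly_decreasing (fun k => p k * c k).
Proof.
  intros (B & d & HB & Hp) Hc q; destruct (Hc (d + q)%nat) as [K HK].
  exists (B * K); intros k; rewrite Rabs_mult.
  assert (H1 : 0 <= INR k + 1) by (pose proof (pos_INR k); lra).
  apply Rle_trans with (B * (INR k + 1) ^ d * Rabs (c k) * (INR k + 1) ^ q).
  - repeat apply Rmult_le_compat_r; auto using pow_le, Rabs_pos.
  - replace (B * (INR k + 1) ^ d * Rabs (c k) * (INR k + 1) ^ q)
      with (B * (Rabs (c k) * (INR k + 1) ^ (d + q))) by (rewrite pow_add; ring).
    now apply Rmult_le_compat_l.
Qed.

Lemma is_series_telescopic : is_series (fun k => / (INR k + 1) - / (INR k + 2)) 1.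
Proof.
  change (is_lim_seq (sum_n (fun k => / (INR k + 1) - / (INR k + 2))) 1).
  apply is_lim_seq_ext with (fun n => 1 - / INR (S (S n))).
  - induction n as [|n IH].
    + rewrite sum_O; simpl; lra.
    + rewrite sum_Sn, <- IH, !S_INR; unfold plus; simpl.
      replace (INR n + 1 + 2) with (INR n + 1 + 1 + 1) by ring; ring.
  - replace (Finite 1) with (Finite (1 - 0)) by (f_equal; ring).
    apply is_lim_seq_minus'; [apply is_lim_seq_const|].
    apply (is_lim_seq_incr_1 (fun n => / INR (S n))), (is_lim_seq_incr_1 (fun n => / INR n)).
    apply (is_lim_seq_inv INR p_infty is_lim_seq_INR); easy.
Qed.

Lemma rapidly_decreasing_ex_series_Rabs (c : nat -> R) :
  rapidly_decreasing c -> ex_series (fun k => Rabs (c k)).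
Proof.
  intros Hc; destruct (Hc 2%nat) as [K HK].
  apply (ex_series_le (K := R_AbsRing) (V := R_CompleteNormedModule) _
           (fun k => 2 * K * (/ (INR k + 1) - / (INR k + 2)))).
  - intros k; specialize (HK k); pose proof (pos_INR k).
    change (Rabs (Rabs (c k)) <= 2 * K * (/ (INR k + 1) - / (INR k + 2))).
    rewrite Rabs_Rabsolu.
    replace (2 * K * (/ (INR k + 1) - / (INR k + 2)))
      with (2 * K * / ((INR k + 1) * (INR k + 2))) by (field; lra).
    apply (Rmult_le_reg_r ((INR k + 1) * (INR k + 2))); [nra|].
    rewrite (Rmult_assoc (2 * K)), Rinv_l, Rmult_1_r by nra.
    pose proof (Rabs_pos (c k)).
    apply Rle_trans with (2 * (Rabs (c k) * (INR k + 1) ^ 2)); [|lra].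
    replace (2 * (Rabs (c k) * (INR k + 1) ^ 2))
      with (Rabs (c k) * (2 * (INR k + 1) ^ 2)) by ring.
    apply Rmult_le_compat_l; [assumption | nra].
  - apply (ex_series_scal_l (K := R_AbsRing) (V := R_NormedModule) (2 * K)
             (fun k => / (INR k + 1) - / (INR k + 2))).
    exists 1; apply is_series_telescopic.
Qed.

Lemma rapidly_decreasing_ex_series (c : nat -> R) : rapidly_decreasing c -> ex_series c.
Proof. intros Hc; now apply ex_series_Rabs, rapidly_decreasing_ex_series_Rabs. Qed.

Lemma rapidly_decreasing_is_lim_seq (p c : nat -> R) :
  poly_growth p -> rapidly_decreasing c -> is_lim_seq (fun k => p k * c k) 0.
Proof.
  intros Hp Hc; apply ex_series_lim_0, rapidly_decreasing_ex_series.
  now apply rapidly_decreasing_mult.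
Qed.

(** Each use of the lowering relation gains a factor k + b and moves to index k + 1 with three other
    values of j; hence the induction on the exponent runs over all j at once. *)
Lemma rapidly_decreasing_laguerre_functional (b lam : R) (r j : nat) :
  0 < b -> 1 <= lam -> (1 <= r)%nat ->
  rapidly_decreasing (fun k => laguerre_functional b (moment b lam r) k j).
Proof.
  intros Hb Hlam Hr.
  set (c := laguerre_functional b (moment b lam r)).
  assert (HN : exists N, b <= INR N /\ (1 <= N)%nat).
  { destruct (INR_unbounded b) as [N HN]; exists (S N); split; [rewrite S_INR; lra | lia]. }
  destruct HN as [N [HbN HN]].
  assert (Hk1 : forall k, 1 <= INR k + 1) by (intros k; pose proof (pos_INR k); lra).
  (* The growth (k+1)^N of the base bound is carried along with N fixed, and removed at the end by
     asking for the exponent N + q. *)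
  assert (H : forall q i, exists K, 0 <= K /\
            forall k, Rabs (c k i) * (INR k + 1) ^ q <= K * (INR k + 1) ^ N).
  { induction q as [|q IH]; intros i.
    - exists (/ 2 * (1 * exp 1 * Rabs (moment b lam r (i * 2))) + / (2 * 1) * Gamma b).
      pose proof (exp_pos 1); pose proof (Rabs_pos (moment b lam r (i * 2))).
      pose proof (Gamma_pos b Hb).
      split; [nra|]; intros k; rewrite pow_O, Rmult_1_r.
      eapply Rle_trans; [now apply laguerre_functional_bound|].
      rewrite Rmult_plus_distr_r; apply Rplus_le_compat.
      + assert (1 <= (INR k + 1) ^ N) by (apply pow_R1_Rle; auto).
        pose proof (Rle_abs (moment b lam r (i * 2))).
        apply Rle_trans with (/ 2 * (1 * exp 1 * Rabs (moment b lam r (i * 2))) * 1).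
        * rewrite Rmult_1_r; apply Rmult_le_compat_l; [lra|]; apply Rmult_le_compat_l; lra.
        * apply Rmult_le_compat_l; [nra | assumption].
      + pose proof (poch_div_fact_le b N k Hb HbN HN).
        replace (/ (2 * 1) * (Gamma b * poch b k / INR (fact k)))
          with (/ (2 * 1) * Gamma b * (poch b k / INR (fact k))) by (unfold Rdiv; ring).
        apply Rmult_le_compat_l; [nra | assumption].
    - destruct (IH (pred i)) as (K1 & HK1 & H1).
      destruct (IH (i + r - 1)%nat) as (K2 & HK2 & H2).
      destruct (IH (i + 2 * r - 1)%nat) as (K3 & HK3 & H3).
      set (A1 := INR i * (INR i + b - 1)) in *.
      set (A2 := lam * INR r * (2 * INR i + b + INR r - 1)).
      set (A3 := (lam * INR r) ^ 2).
      (* The factor 1 + 1/b comes from k + 1 <= (1 + 1/b)(k + b), and 2^N from (k + 2)^N <= 2^N (k +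
         1)^N. *)
      exists ((1 + / b) * (Rabs A1 * K1 + Rabs A2 * K2 + Rabs A3 * K3) * 2 ^ N).
      assert (Hib : 0 < / b) by (now apply Rinv_0_lt_compat).
      pose proof (Rabs_pos A1); pose proof (Rabs_pos A2); pose proof (Rabs_pos A3).
      assert (HKs : 0 <= Rabs A1 * K1 + Rabs A2 * K2 + Rabs A3 * K3)
        by (repeat apply Rplus_le_le_0_compat; now apply Rmult_le_pos).
      split; [apply Rmult_le_pos; [apply Rmult_le_pos; lra | apply pow_le; lra]|].
      intros k.
      pose proof (laguerre_functional_lower b lam r (moment b lam r) k i Hb Hr
        (fun n => moment_shift b lam r n Hb (Rlt_le_trans _ _ _ Rlt_0_1 Hlam) Hr)) as Hlow.
      fold c A1 A2 A3 in Hlow.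
      assert (Hkb : Rabs (c k i) * (INR k + b) <=
        Rabs A1 * Rabs (c (S k) (pred i)) + Rabs A2 * Rabs (c (S k) (i + r - 1)%nat)
        + Rabs A3 * Rabs (c (S k) (i + 2 * r - 1)%nat)).
      { replace (Rabs (c k i) * (INR k + b)) with (Rabs (- (INR k + b) * c k i)).
        - rewrite Hlow, <- !Rabs_mult; unfold Rminus.
          eapply Rle_trans; [apply Rabs_triang|]; apply Rplus_le_compat_r.
          eapply Rle_trans; [apply Rabs_triang|]; rewrite Rabs_Ropp; lra.
        - pose proof (pos_INR k).
          rewrite Rabs_mult, Rabs_Ropp, (Rabs_right (INR k + b)) by lra; ring. }
      specialize (H1 (S k)); specialize (H2 (S k)); specialize (H3 (S k)).
      pose proof (pos_INR k) as Hk0; pose proof (Hk1 (S k)) as HSk.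
      assert (Hq0 : 0 <= (INR k + 1) ^ q) by (apply pow_le; lra).
      assert (Hq1 : (INR k + 1) ^ q <= (INR (S k) + 1) ^ q)
        by (apply pow_incr; rewrite S_INR; lra).
      assert (HN2 : (INR (S k) + 1) ^ N <= 2 ^ N * (INR k + 1) ^ N)
        by (rewrite <- Rpow_mult_distr; apply pow_incr; rewrite S_INR; lra).
      apply Rle_trans with ((1 + / b) * ((Rabs (c k i) * (INR k + b)) * (INR k + 1) ^ q)).
      { simpl pow.
        replace ((1 + / b) * (Rabs (c k i) * (INR k + b) * (INR k + 1) ^ q)) with
          (Rabs (c k i) * (((1 + / b) * (INR k + b)) * (INR k + 1) ^ q)) by ring.
        apply Rmult_le_compat_l; [apply Rabs_pos|].
        apply Rmult_le_compat_r; [assumption|].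
        replace ((1 + / b) * (INR k + b)) with (INR k + b + INR k * / b + 1) by (field; lra).
        assert (0 <= INR k * / b) by (apply Rmult_le_pos; lra); lra. }
      rewrite !(Rmult_assoc (1 + / b)).
      apply Rmult_le_compat_l; [lra|].
      apply Rle_trans with ((Rabs A1 * Rabs (c (S k) (pred i)) + Rabs A2 * Rabs (c (S k) (i + r - 1)%nat)
        + Rabs A3 * Rabs (c (S k) (i + 2 * r - 1)%nat)) * (INR (S k) + 1) ^ q).
      { apply Rmult_le_compat; try assumption.
        apply Rmult_le_pos; [apply Rabs_pos | lra]. }
      apply Rle_trans with ((Rabs A1 * K1 + Rabs A2 * K2 + Rabs A3 * K3) * (INR (S k) + 1) ^ N).
      { rewrite !Rmult_plus_distr_r, !(Rmult_assoc (Rabs _)).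
        repeat apply Rplus_le_compat; apply Rmult_le_compat_l; assumption. }
      eapply Rle_trans; [apply Rmult_le_compat_l; [exact HKs | exact HN2]|]; right; ring. }
  intros q; destruct (H (N + q)%nat j) as (K & HK & HKk).
  exists K; intros k; specialize (HKk k); fold c.
  assert (Hp : 0 < (INR k + 1) ^ N) by (apply pow_lt; specialize (Hk1 k); lra).
  apply (Rmult_le_reg_r ((INR k + 1) ^ N)); [exact Hp|].
  rewrite pow_add in HKk; lra.
Qed.

(** * Summation of Laguerre coefficients *)

Lemma pow_le_1 (x : R) (n : nat) : 0 <= x <= 1 -> x ^ n <= 1.
Proof. intros Hx; rewrite <- (pow1 n); apply pow_incr; lra. Qed.

(** Sum of the terms of index below n. Unlike [sum_n] it starts from the empty sum, the natural base
    case for remainders and for blocks of r terms. *)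
Fixpoint psum (f : nat -> R) (n : nat) : R :=
  match n with
  | O => 0
  | S m => psum f m + f m
  end.

Lemma psum_S (f : nat -> R) (n : nat) : psum f (S n) = sum_n f n.
Proof.
  rewrite sum_n_Reals; induction n as [|n IH]; [simpl; ring|].
  simpl sum_f_R0; rewrite <- IH; reflexivity.
Qed.

Lemma is_lim_seq_psum (f : nat -> R) (l : R) : is_series f l -> is_lim_seq (psum f) l.
Proof.
  intros H; apply is_lim_seq_incr_1.
  apply is_lim_seq_ext with (sum_n f); [intros n; now rewrite psum_S | exact H].
Qed.

Lemma Series_le_of_ex (a b : nat -> R) :
  (forall k, a k <= b k) -> ex_series a -> ex_series b -> Series a <= Series b.
Proof.
  intros Hab Ha Hb.
  apply Series_correct in Ha; apply Series_correct in Hb.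
  apply is_lim_seq_psum in Ha; apply is_lim_seq_psum in Hb.
  apply (is_lim_seq_le _ _ (Finite _) (Finite _)) with (2 := Ha) (3 := Hb).
  intros n; induction n as [|n IH]; simpl; [lra | specialize (Hab n); lra].
Qed.

Definition laguerre_psum (b t : R) (n : nat) (u : R) : R :=
  psum (fun k => t ^ k * laguerre b k u) n.

(** By orthogonality, removing the terms of index below n leaves the coefficients of index at least
    n unchanged. *)
Lemma weighted_integral_remainder_laguerre (b t : R) (k n : nat) :
  0 < b -> 0 < t < 1 -> (n <= k)%nat ->
  weighted_integral b
    (fun u => (laguerre_gf b t u - laguerre_psum b t n u) * laguerre b k u * exp (- u))
    (Gamma b * poch b k / INR (fact k) * t ^ k).
Proof.
  intros Hb Ht; induction n as [|n IH]; intros Hn.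
  - eapply weighted_integral_ext; [|reflexivity|exact (weighted_integral_gf_laguerre b t k Hb Ht)].
    intros u _; unfold laguerre_psum; simpl; ring.
  - assert (Hnk : (n <= k)%nat) by lia.
    pose proof (weighted_integral_laguerre_laguerre b k n Hb Hnk) as Ho.
    destruct (Nat.eq_dec n k) as [->|_]; [lia|].
    eapply weighted_integral_ext; [| |
      exact (weighted_integral_minus _ _ _ _ _ (IH Hnk) (weighted_integral_scal _ (t ^ n) _ _ Ho))].
    + intros u _; unfold laguerre_psum; simpl psum; ring.
    + ring.
Qed.

(** Pythagoras with an exact remainder. By the binomial series at t^2 the right side tends to 0 as n
    grows: the partial sums converge to [laguerre_gf] in mean square. *)
Lemma weighted_integral_remainder_sqr (b t : R) (n : nat) :
  0 < b -> 0 < t < 1 ->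
  weighted_integral b
    (fun u => (laguerre_gf b t u - laguerre_psum b t n u) ^ 2 * exp (- u))
    (Gamma b * (Rpower (1 - t ^ 2) (- b)
                - psum (fun k => poch b k / INR (fact k) * (t ^ 2) ^ k) n)).
Proof.
  intros Hb Ht; induction n as [|n IH].
  - eapply weighted_integral_ext; [| |exact (weighted_integral_gf_sqr b t Hb Ht)].
    + intros u _; unfold laguerre_psum; simpl; ring.
    + simpl psum; ring.
  - pose proof (weighted_integral_laguerre_laguerre b n n Hb (le_n n)) as Ho.
    destruct (Nat.eq_dec n n) as [_|]; [|easy].
    eapply weighted_integral_ext; [| |
      exact (weighted_integral_plus _ _ _ _ _
        (weighted_integral_minus _ _ _ _ _ IH
          (weighted_integral_scal _ (2 * t ^ n) _ _
            (weighted_integral_remainder_laguerre b t n n Hb Ht (le_n n))))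
        (weighted_integral_scal _ (t ^ n * t ^ n) _ _ Ho))].
    + intros u _; unfold laguerre_psum; simpl psum; ring.
    + cbn [psum]; replace ((t ^ 2) ^ n) with (t ^ n * t ^ n) by (rewrite <- Rpow_mult_distr; f_equal; ring).
      unfold Rdiv; ring.
Qed.

Lemma weighted_integral_exp_laguerre_psum (b lam t : R) (r n : nat) :
  0 < b -> 0 < lam -> (1 <= r)%nat ->
  weighted_integral b (fun u => u ^ 0 * exp (- (lam * u ^ r)) * laguerre_psum b t n u)
    (psum (fun k => t ^ k * laguerre_functional b (moment b lam r) k 0) n).
Proof.
  intros Hb Hlam Hr; induction n as [|n IH].
  - eapply weighted_integral_ext; [| |
      exact (weighted_integral_scal _ 0 _ _ (weighted_integral_moment b lam r 0 Hb Hlam Hr))].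
    + intros u _; unfold laguerre_psum; simpl; ring.
    + simpl; ring.
  - eapply weighted_integral_ext; [| |
      exact (weighted_integral_plus _ _ _ _ _ IH (weighted_integral_scal _ (t ^ n) _ _
        (weighted_integral_moment_laguerre b lam r n 0 Hb Hlam Hr)))].
    + intros u _; unfold laguerre_psum; simpl psum; ring.
    + reflexivity.
Qed.

(** From (1 - lam u^r) G <= exp (-lam u^r) G, with G = [laguerre_gf] split into partial sum and
    remainder; AM-GM with a free eps bounds the remainder part by its squared norm. *)
Lemma laguerre_psum_lower (b lam t eps : R) (r n : nat) :
  0 < b -> 1 <= lam -> (1 <= r)%nat -> 0 < t < 1 -> 0 < eps ->
  Gamma b * Rpower t (- b) * (1 - lam * poch b r * ((1 - t) / t) ^ r) <=
  psum (fun k => t ^ k * laguerre_functional b (moment b lam r) k 0) n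
  + (/ 2 * (eps * exp 1 * moment b lam r 0)
     + / (2 * eps) * (Gamma b * (Rpower (1 - t ^ 2) (- b)
                - psum (fun k => poch b k / INR (fact k) * (t ^ 2) ^ k) n))).
Proof.
  intros Hb Hlam Hr Ht Heps.
  assert (Hlam0 : 0 < lam) by lra.
  eapply weighted_integral_le; [|exact (weighted_integral_gf_lower b lam t r Hb Ht)|
    exact (weighted_integral_plus _ _ _ _ _
      (weighted_integral_exp_laguerre_psum b lam t r n Hb Hlam0 Hr)
      (weighted_integral_plus _ _ _ _ _
        (weighted_integral_scal _ (/ 2) _ _ (weighted_integral_scal _ (eps * exp 1) _ _
          (weighted_integral_moment b lam r 0 Hb Hlam0 Hr)))
        (weighted_integral_scal _ (/ (2 * eps)) _ _
          (weighted_integral_remainder_sqr b t n Hb Ht))))].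
  intros u Hu; cbv beta.
  assert (HG : 0 < laguerre_gf b t u) by (apply Rmult_lt_0_compat; apply exp_pos).
  assert (H1 : 1 - lam * u ^ r <= exp (- (lam * u ^ r)))
    by (pose proof (exp_ineq1_le (- (lam * u ^ r))); lra).
  pose proof (exp_pow_mult_le lam (u ^ 0) (laguerre_gf b t u - laguerre_psum b t n u) u eps r
                Hlam Hr Hu Heps) as H2.
  rewrite !pow_O in *.
  replace (1 ^ 2) with 1 in H2 by ring.
  assert ((1 - lam * u ^ r) * laguerre_gf b t u <= exp (- (lam * u ^ r)) * laguerre_gf b t u)
    by (apply Rmult_le_compat_r; lra).
  lra.
Qed.

Lemma ex_series_pow_laguerre (b lam t : R) (r : nat) :
  0 < b -> 1 <= lam -> (1 <= r)%nat -> 0 < t < 1 ->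
  ex_series (fun k => t ^ k * laguerre_functional b (moment b lam r) k 0).
Proof.
  intros Hb Hlam Hr Ht.
  apply rapidly_decreasing_ex_series, rapidly_decreasing_mult;
    [|now apply rapidly_decreasing_laguerre_functional].
  exists 1, 0%nat; split; [lra|]; intros k.
  rewrite pow_O, Rmult_1_r, Rabs_right by (apply Rle_ge, pow_le; lra).
  apply pow_le_1; lra.
Qed.

(** Order of limits: n -> oo at fixed eps removes the squared norm of the remainder, then a small
    eps makes the fixed moment term negligible. *)
Lemma laguerre_series_lower (b lam t : R) (r : nat) :
  0 < b -> 1 <= lam -> (1 <= r)%nat -> 0 < t < 1 ->
  Gamma b * Rpower t (- b) * (1 - lam * poch b r * ((1 - t) / t) ^ r) <=
  Series (fun k => t ^ k * laguerre_functional b (moment b lam r) k 0).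
Proof.
  intros Hb Hlam Hr Ht.
  set (A := Gamma b * _ * _); set (S0 := Series _).
  assert (Heps : forall eps, 0 < eps ->
    A <= S0 + (/ 2 * (eps * exp 1 * moment b lam r 0) + / (2 * eps) * (Gamma b * 0))).
  { intros eps Heps.
    apply (is_lim_seq_le (fun _ => A)
     (fun n => psum (fun k => t ^ k * laguerre_functional b (moment b lam r) k 0) n
       + (/ 2 * (eps * exp 1 * moment b lam r 0)
       + / (2 * eps) * (Gamma b * (Rpower (1 - t ^ 2) (- b)
                - psum (fun k => poch b k / INR (fact k) * (t ^ 2) ^ k) n))))
     (Finite _) (Finite _)).
    - intros n; now apply laguerre_psum_lower.
    - apply is_lim_seq_const.
    - apply is_lim_seq_plus'.
      + apply is_lim_seq_psum, Series_correct; now apply ex_series_pow_laguerre.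
      + apply is_lim_seq_plus'; [apply is_lim_seq_const|].
        apply (is_lim_seq_scal_l _ (/ (2 * eps)) (Finite _)), (is_lim_seq_scal_l _ (Gamma b) (Finite _)).
        replace 0 with (Rpower (1 - t ^ 2) (- b) - Rpower (1 - t ^ 2) (- b)) by ring.
        apply is_lim_seq_minus'; [apply is_lim_seq_const|].
        apply is_lim_seq_psum, is_series_poch_binomial; [exact Hb | nra]. }
  apply Rnot_lt_le; intros Hlt.
  (* With eps = (A - S0)/K the error term is at most half of A - S0, which contradicts A - S0 >
     0. *)
  set (K := exp 1 * Rabs (moment b lam r 0) + 1).
  assert (HK : 1 <= K).
  { pose proof (exp_pos 1); pose proof (Rabs_pos (moment b lam r 0)).
    assert (0 <= exp 1 * Rabs (moment b lam r 0)) by (apply Rmult_le_pos; lra).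
    unfold K; lra. }
  assert (He : 0 < (A - S0) / K) by (apply Rdiv_lt_0_compat; lra).
  specialize (Heps _ He).
  assert ((A - S0) / K * exp 1 * moment b lam r 0 <= A - S0).
  { replace (A - S0) with ((A - S0) / K * K) at 2 by (field; lra).
    rewrite Rmult_assoc; apply Rmult_le_compat_l; [lra|]; unfold K.
    pose proof (exp_pos 1); pose proof (Rle_abs (moment b lam r 0)).
    assert (exp 1 * moment b lam r 0 <= exp 1 * Rabs (moment b lam r 0))
      by (apply Rmult_le_compat_l; lra); lra. }
  lra.
Qed.

Lemma one_minus_pow_le (t : R) (k : nat) : 0 <= t <= 1 -> 1 - t ^ k <= INR k * (1 - t).
Proof.
  intros Ht; induction k as [|k IH]; [simpl; lra|].
  rewrite S_INR; simpl pow.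
  assert (0 <= t ^ k <= 1) by (split; [apply pow_le; lra | apply pow_le_1; lra]).
  nra.
Qed.

(* Abel summation: the generating function tends to a point mass at 0 as [t -> 1]. *)
Lemma laguerre_series_pos (b lam : R) (r : nat) :
  0 < b -> 1 <= lam -> (1 <= r)%nat ->
  0 < Series (fun k => laguerre_functional b (moment b lam r) k 0).
Proof.
  intros Hb Hlam Hr.
  set (c := fun k => laguerre_functional b (moment b lam r) k 0).
  assert (Hc : rapidly_decreasing c) by (now apply rapidly_decreasing_laguerre_functional).
  assert (Hkc : ex_series (fun k => INR k * Rabs (c k))).
  { eapply ex_series_ext; [|apply rapidly_decreasing_ex_series_Rabs,
      (rapidly_decreasing_mult INR c poly_growth_INR Hc)].
    intros k; cbv beta; rewrite Rabs_mult, (Rabs_right (INR k)) by (apply Rle_ge, pos_INR); easy. }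
  set (B := Series (fun k => INR k * Rabs (c k))).
  (* As 1 - t^k <= k (1 - t), passing from t to 1 costs at most (1 - t) times a convergent
     series. *)
  assert (HB : forall t, 0 < t < 1 -> Series (fun k => t ^ k * c k) <= Series c + (1 - t) * B).
  { intros t Ht; unfold B; rewrite <- Series_scal_l, <- Series_plus.
    - apply Series_le_of_ex.
      + intros k; pose proof (one_minus_pow_le t k) as H1.
        assert (0 <= t ^ k <= 1)
          by (split; [apply pow_le; lra | apply pow_le_1; lra]).
        assert ((1 - t ^ k) * - c k <= (INR k * (1 - t)) * Rabs (c k)); [|lra].
        pose proof (Rle_abs (- c k)) as Ha; rewrite Rabs_Ropp in Ha.
        apply Rle_trans with ((1 - t ^ k) * Rabs (c k)).
        * apply Rmult_le_compat_l; lra.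
        * apply Rmult_le_compat_r; [apply Rabs_pos | lra].
      + now apply ex_series_pow_laguerre.
      + apply (ex_series_plus (K := R_AbsRing) (V := R_NormedModule) c);
          [now apply rapidly_decreasing_ex_series|].
        now apply (ex_series_scal_l (K := R_AbsRing) (V := R_NormedModule)).
    - now apply rapidly_decreasing_ex_series.
    - now apply (ex_series_scal_l (K := R_AbsRing) (V := R_NormedModule)). }
  set (C := lam * poch b r).
  assert (HC : 0 < C) by (apply Rmult_lt_0_compat; [lra | now apply poch_pos]).
  pose proof (Gamma_pos b Hb) as HG.
  set (K := 2 * C * Gamma b + Rabs B + 2 * C + 2 + Gamma b).
  assert (HCG : 0 < C * Gamma b) by (now apply Rmult_lt_0_compat).
  assert (HK : 0 < K) by (unfold K; pose proof (Rabs_pos B); lra).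
  (* At t = 1 - del the lower bound is at least Gamma(b) (1 - 2 C del) and the upper bound is the
     sum plus del B. As K dominates 2 C Gamma(b) + B, the last bound on del leaves at least
     Gamma(b)/2 for the sum. The other two ensure del/(1-del) <= 2 del and 2 C del <= 1. *)
  set (del := Rmin (/ 2) (Rmin (/ (2 * C)) (Gamma b / (2 * K)))).
  assert (Hd : 0 < del).
  { repeat apply Rmin_glb_lt; try (apply Rinv_0_lt_compat; lra); apply Rdiv_lt_0_compat; lra. }
  assert (Hd1 : del <= / 2) by apply Rmin_l.
  assert (Hd2 : del <= / (2 * C)) by (eapply Rle_trans; [apply Rmin_r | apply Rmin_l]).
  assert (Hd3 : del <= Gamma b / (2 * K)) by (eapply Rle_trans; [apply Rmin_r | apply Rmin_r]).
  assert (Ht : 0 < 1 - del < 1) by lra.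
  specialize (HB _ Ht).
  pose proof (laguerre_series_lower b lam (1 - del) r Hb Hlam Hr Ht) as Hl.
  fold (c 0%nat) C in Hl.
  replace (1 - (1 - del)) with del in * by ring.
  assert (Hq : 0 <= del / (1 - del) <= 2 * del).
  { split; [apply Rlt_le, Rdiv_lt_0_compat; lra|].
    apply (Rmult_le_reg_r (1 - del)); [lra|].
    unfold Rdiv; rewrite Rmult_assoc, Rinv_l by lra; nra. }
  assert (Hqr : (del / (1 - del)) ^ r <= 2 * del).
  { replace r with (S (pred r)) by lia; simpl.
    assert ((del / (1 - del)) ^ pred r <= 1) by (apply pow_le_1; lra).
    assert (0 <= (del / (1 - del)) ^ pred r) by (apply pow_le; lra).
    nra. }
  assert (H2C : C * (2 * del) <= 1).
  { apply (Rmult_le_compat_l (2 * C)) in Hd2; [|lra]; rewrite Rinv_r in Hd2 by lra; lra. }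
  assert (HP : 1 <= Rpower (1 - del) (- b)).
  { assert (Hln : ln (1 - del) < ln 1) by (apply ln_increasing; lra); rewrite ln_1 in Hln.
    assert (0 <= - b * ln (1 - del)) by nra.
    pose proof (exp_ineq1_le (- b * ln (1 - del))); unfold Rpower; lra. }
  assert (Hfac : 0 <= 1 - C * (2 * del) <= 1 - C * (del / (1 - del)) ^ r).
  { split; [lra|]; apply Rplus_le_compat_l, Ropp_le_contravar, Rmult_le_compat_l; lra. }
  assert (Hlow : Gamma b * 1 * (1 - C * (2 * del)) <=
     Gamma b * Rpower (1 - del) (- b) * (1 - C * (del / (1 - del)) ^ r)).
  { apply Rmult_le_compat; [lra | lra | apply Rmult_le_compat_l; lra | lra]. }
  assert (HdK : del * K <= Gamma b / 2).
  { apply (Rmult_le_compat_r K) in Hd3; [|lra].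
    replace (Gamma b / (2 * K) * K) with (Gamma b / 2) in Hd3 by (field; lra); exact Hd3. }
  assert (HdB : del * (2 * C * Gamma b + B) <= del * K)
    by (apply Rmult_le_compat_l; [lra|]; unfold K; pose proof (Rle_abs B); lra).
  change (Series (fun k => (1 - del) ^ k * laguerre_functional b (moment b lam r) k 0))
    with (Series (fun k => (1 - del) ^ k * c k)) in Hl.
  lra.
Qed.

(** The partial sums are the boundary term of the telescoped recurrence, whose linear factors are
    beaten by rapid decay. *)
Lemma Series_laguerre_functional_S (b lam : R) (r j : nat) :
  0 < b -> 1 <= lam -> (1 <= r)%nat ->
  Series (fun k => laguerre_functional b (moment b lam r) k (S j)) = 0.
Proof.
  intros Hb Hlam Hr; apply is_series_unique.
  pose proof (rapidly_decreasing_laguerre_functional b lam r j Hb Hlam Hr) as Hc.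
  set (c := fun k => laguerre_functional b (moment b lam r) k j) in Hc.
  change (is_lim_seq (sum_n (fun k => laguerre_functional b (moment b lam r) k (S j))) 0).
  apply is_lim_seq_ext with (fun n => (INR n + b) * c n - INR (S n) * c (S n)).
  - intros n; rewrite sum_n_Reals, sum_laguerre_functional_S by exact Hb; easy.
  - replace (Finite 0) with (Finite (0 - 0)) by (f_equal; ring).
    apply is_lim_seq_minus'.
    + apply rapidly_decreasing_is_lim_seq; [|exact Hc].
      apply poly_growth_plus; [apply poly_growth_INR | apply poly_growth_const].
    + apply (is_lim_seq_incr_1 (fun n => INR n * c n)).
      apply rapidly_decreasing_is_lim_seq; [apply poly_growth_INR | exact Hc].
Qed.

(** * Powers of A under the summation over k *)

Lemma poly_growth_poch (b : R) (n : nat) : poly_growth (fun k => poch (b + INR k) n).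
Proof.
  induction n as [|n IH]; [apply (poly_growth_const 1)|].
  simpl; apply poly_growth_mult; [exact IH|].
  apply poly_growth_plus; [|apply poly_growth_const].
  apply poly_growth_plus; [apply poly_growth_const | apply poly_growth_INR].
Qed.

Definition poch_series (b lam : R) (r n j : nat) : R :=
  Series (fun k => poch (b + INR k) n * laguerre_functional b (moment b lam r) k j).

Lemma ex_poch_series (b lam : R) (r n j : nat) :
  0 < b -> 1 <= lam -> (1 <= r)%nat ->
  ex_series (fun k => poch (b + INR k) n * laguerre_functional b (moment b lam r) k j).
Proof.
  intros Hb Hlam Hr; apply rapidly_decreasing_ex_series, rapidly_decreasing_mult.
  - apply poly_growth_poch.
  - now apply rapidly_decreasing_laguerre_functional.
Qed.

(** In (b+k)_(n+1) = (b+k) (b+k+1)_n the factor b + k is used up by the lowering relation, and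
    (b+k+1)_n is the weight that belongs to index k + 1, so the sum can be reindexed. The term of
    index 0 that reindexing adds is 0 because A L_0 = 0. *)
Lemma poch_series_S (b lam : R) (r n j : nat) :
  0 < b -> 1 <= lam -> (1 <= r)%nat ->
  poch_series b lam r (S n) j =
  - (INR j * (INR j + b - 1) * poch_series b lam r n (pred j)
     - lam * INR r * (2 * INR j + b + INR r - 1) * poch_series b lam r n (j + r - 1)
     + (lam * INR r) ^ 2 * poch_series b lam r n (j + 2 * r - 1)).
Proof.
  intros Hb Hlam Hr.
  assert (Hm : forall n, lam * INR r * moment b lam r (n + r) = (b + INR n) * moment b lam r n)
    by (intros i; apply moment_shift; lra || assumption).
  unfold poch_series.
  set (c := laguerre_functional b (moment b lam r)).
  set (A1 := INR j * (INR j + b - 1)).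
  set (A2 := lam * INR r * (2 * INR j + b + INR r - 1)).
  set (A3 := (lam * INR r) ^ 2).
  assert (Hex : forall i, is_series (fun k => poch (b + INR k) n * c k i)
      (Series (fun k => poch (b + INR k) n * c k i)))
    by (intros i; apply Series_correct; now apply ex_poch_series).
  assert (Hs : is_series (fun k => poch (b + INR k) n *
      (A1 * c k (pred j) - A2 * c k (j + r - 1)%nat + A3 * c k (j + 2 * r - 1)%nat))
    (A1 * Series (fun k => poch (b + INR k) n * c k (pred j))
     - A2 * Series (fun k => poch (b + INR k) n * c k (j + r - 1)%nat)
     + A3 * Series (fun k => poch (b + INR k) n * c k (j + 2 * r - 1)%nat))).
  { eapply is_series_ext; [|exact (is_series_plus _ _ _ _
      (is_series_minus _ _ _ _ (is_series_scal A1 _ _ (Hex (pred j)))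
         (is_series_scal A2 _ _ (Hex (j + r - 1)%nat)))
      (is_series_scal A3 _ _ (Hex (j + 2 * r - 1)%nat)))].
    intros k; unfold plus, opp, scal; simpl; unfold mult; simpl; ring. }
  rewrite <- (is_series_unique _ _ Hs), (Series_incr_1 _ (ex_intro _ _ Hs)).
  replace (A1 * c 0%nat (pred j) - A2 * c 0%nat (j + r - 1)%nat
           + A3 * c 0%nat (j + 2 * r - 1)%nat) with 0.
  - rewrite Rmult_0_r, Rplus_0_l, <- Series_opp.
    apply Series_ext; intros k.
    pose proof (laguerre_functional_lower b lam r _ k j Hb Hr Hm) as Hlow.
    fold c A1 A2 A3 in Hlow; rewrite <- Hlow, poch_S_l, S_INR, <- Rplus_assoc; ring.
  - pose proof (moment_lower_0 b lam r _ j Hr Hm) as H0; fold A1 A2 A3 in H0.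
    unfold c, laguerre_functional; cbn [sum_f_R0]; rewrite !Nat.add_0_r.
    transitivity (laguerre_coef b 0 0 * 0); [ring|]; rewrite <- H0; ring.
Qed.

(** * The generating function *)

Definition exp_pow_coef (rho : R) (r m : nat) : R :=
  if Nat.eqb (m mod r) 0 then rho ^ (m / r) / INR (fact (m / r)) else 0.

Lemma exp_pow_coef_0 (rho : R) (r : nat) : (1 <= r)%nat -> exp_pow_coef rho r 0 = 1.
Proof.
  intros Hr; unfold exp_pow_coef; rewrite Nat.Div0.mod_0_l, Nat.Div0.div_0_l; simpl; field.
Qed.

Lemma exp_pow_coef_small (rho : R) (r m : nat) : (0 < m < r)%nat -> exp_pow_coef rho r m = 0.
Proof.
  intros Hm; unfold exp_pow_coef; rewrite Nat.mod_small by lia.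
  now destruct m; [lia|].
Qed.

(** The equation E' = r rho z^(r-1) E for E = exp (rho z^r), read on coefficients. *)
Lemma exp_pow_coef_add (rho : R) (r m : nat) :
  (1 <= r)%nat ->
  INR (m + r) * exp_pow_coef rho r (m + r) = INR r * rho * exp_pow_coef rho r m.
Proof.
  intros Hr; unfold exp_pow_coef.
  replace (m + r)%nat with (m + 1 * r)%nat at 2 by lia.
  rewrite Nat.Div0.mod_add.
  destruct (Nat.eqb_spec (m mod r) 0) as [H0|H0]; [|ring].
  replace (m + r)%nat with (m + 1 * r)%nat at 2 3 by lia.
  rewrite Nat.div_add by lia.
  rewrite (Nat.div_mod_eq m r) at 1; rewrite H0, Nat.add_0_r.
  set (q := (m / r)%nat); rewrite Nat.add_1_r, fact_simpl, mult_INR, plus_INR, mult_INR, S_INR.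
  pose proof (INR_fact_lt_0 q); pose proof (pos_INR q); simpl pow; field; lra.
Qed.

(** There are ceil(n/r) multiples of r among the indices below n, so these partial sums are those of
    the exponential series, each repeated r times after the empty one. *)
Lemma psum_exp_pow_coef (rho z : R) (r n : nat) :
  (1 <= r)%nat ->
  psum (fun m => exp_pow_coef rho r m * z ^ m) n
  = psum (fun q => (rho * z ^ r) ^ q / INR (fact q)) ((n + r - 1) / r).
Proof.
  intros Hr; induction n as [|n IH].
  - rewrite Nat.div_small by lia; easy.
  - cbn [psum]; rewrite IH; unfold exp_pow_coef.
    destruct (Nat.eqb_spec (n mod r) 0) as [H0|H0].
    + pose proof (Nat.div_mod_eq n r) as Hn; rewrite H0, Nat.add_0_r in Hn.
      replace ((n + r - 1) / r)%nat with (n / r)%nat.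
      * replace ((S n + r - 1) / r)%nat with (S (n / r)).
        -- cbn [psum]; apply Rplus_eq_compat_l; rewrite Rpow_mult_distr, <- pow_mult, <- Hn; field.
           apply INR_fact_neq_0.
        -- replace (S n + r - 1)%nat with (n + 1 * r)%nat by lia.
           rewrite Nat.div_add by lia; lia.
      * rewrite Hn at 2; replace (r * (n / r) + r - 1)%nat with ((r - 1) + (n / r) * r)%nat by lia.
        rewrite Nat.div_add, (Nat.div_small (r - 1)) by lia; lia.
    + rewrite Rmult_0_l, Rplus_0_r; f_equal.
      pose proof (Nat.div_mod_eq n r) as Hn.
      pose proof (Nat.mod_upper_bound n r ltac:(lia)).
      replace (n + r - 1)%nat with ((n mod r - 1) + (n / r + 1) * r)%nat by lia.
      replace (S n + r - 1)%nat with ((n mod r) + (n / r + 1) * r)%nat by lia.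
      rewrite !Nat.div_add, (Nat.div_small (n mod r)), (Nat.div_small (n mod r - 1)) by lia; lia.
Qed.

Lemma is_pseries_iff (a : nat -> R) (z l : R) :
  is_pseries a z l <-> is_series (fun n => a n * z ^ n) l.
Proof.
  assert (H : forall n, scal (pow_n z n) (a n) = a n * z ^ n)
    by (intros n; rewrite pow_n_pow; apply Rmult_comm).
  split; intros Hl; [refine (is_series_ext _ _ _ H Hl)|].
  refine (is_series_ext _ _ _ (fun n => eq_sym (H n)) Hl).
Qed.

Lemma is_series_exp (z : R) : is_series (fun n => / INR (fact n) * z ^ n) (exp z).
Proof. apply (is_pseries_iff (fun n => / INR (fact n))), is_exp_Reals. Qed.

Lemma is_series_of_psum (f : nat -> R) (l : R) : is_lim_seq (psum f) l -> is_series f l.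
Proof.
  intros H; apply is_lim_seq_incr_1 in H.
  change (is_lim_seq (sum_n f) l).
  eapply is_lim_seq_ext; [|exact H]; intros n; apply psum_S.
Qed.

Lemma is_pseries_exp_pow (rho z : R) (r : nat) :
  (1 <= r)%nat -> is_pseries (exp_pow_coef rho r) z (exp (rho * z ^ r)).
Proof.
  intros Hr; apply is_pseries_iff, is_series_of_psum.
  eapply is_lim_seq_ext; [intros n; symmetry; now apply psum_exp_pow_coef|].
  apply (is_lim_seq_subseq (psum (fun q => (rho * z ^ r) ^ q / INR (fact q))) _
           (fun n => ((n + r - 1) / r)%nat)).
  - intros P [N HN]; exists (r * N)%nat; intros n Hn; apply HN.
    apply Nat.div_le_lower_bound; lia.
  - apply is_lim_seq_psum.
    eapply is_series_ext; [|apply is_series_exp].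
    intros q; apply Rmult_comm.
Qed.

Lemma CV_radius_entire (a : nat -> R) : (forall z, ex_pseries a z) -> CV_radius a = p_infty.
Proof.
  intros H.
  destruct (CV_radius a) as [rad| |] eqn:Hr; [| easy |].
  - exfalso; apply (CV_disk_outside a (Rabs rad + 1)).
    + rewrite Hr; simpl; rewrite (Rabs_right (Rabs rad + 1)) by (pose proof (Rabs_pos rad); lra).
      pose proof (Rle_abs rad); lra.
    + destruct (H (Rabs rad + 1)) as [l Hl]; apply is_pseries_iff in Hl.
      apply ex_series_lim_0; now exists l.
  - exfalso; pose proof (CV_radius_ge_0 a) as H0; rewrite Hr in H0; exact H0.
Qed.

Lemma is_pseries_mult_entire (a b : nat -> R) (z la lb : R) :
  (forall z, ex_pseries a z) -> (forall z, ex_pseries b z) ->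
  is_pseries a z la -> is_pseries b z lb -> is_pseries (PS_mult a b) z (la * lb).
Proof.
  intros Ha Hb Hla Hlb; apply is_pseries_mult; try assumption;
    rewrite CV_radius_entire by assumption; easy.
Qed.

Lemma is_pseries_entire_unique (a b : nat -> R) (f : R -> R) (n : nat) :
  (forall z, is_pseries a z (f z)) -> (forall z, is_pseries b z (f z)) -> a n = b n.
Proof.
  intros Ha Hb; apply PSeries_ext_recip.
  - rewrite CV_radius_entire; [easy | intros z; exists (f z); apply Ha].
  - rewrite CV_radius_entire; [easy | intros z; exists (f z); apply Hb].
  - apply filter_forall; intros z.
    rewrite (is_pseries_unique _ _ _ (Ha z)), (is_pseries_unique _ _ _ (Hb z)); easy.
Qed.

(** * The Kummer transformation and the polynomials M_n *)

Lemma Rabs_poch_ratio_le (x b : R) (m : nat) :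
  0 < b -> Rabs (poch x m / poch b m) <= (1 + Rabs x / b) ^ m.
Proof.
  intros Hb; induction m as [|m IH].
  - simpl; rewrite Rdiv_1_r, Rabs_R1; lra.
  - pose proof (poch_pos b m Hb); pose proof (pos_INR m); pose proof (Rabs_pos x).
    replace (poch x (S m) / poch b (S m))
      with ((x + INR m) / (b + INR m) * (poch x m / poch b m)) by (simpl; field; lra).
    rewrite Rabs_mult; simpl pow.
    apply Rmult_le_compat; auto using Rabs_pos.
    rewrite Rabs_div, (Rabs_right (b + INR m)) by lra.
    apply (Rmult_le_reg_r (b + INR m)); [lra|].
    unfold Rdiv; rewrite Rmult_assoc, Rinv_l, Rmult_1_r by lra.
    eapply Rle_trans; [apply Rabs_triang|]; rewrite (Rabs_right (INR m)) by lra.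
    replace ((1 + Rabs x * / b) * (b + INR m))
      with (b + INR m + Rabs x + Rabs x * / b * INR m) by (field; lra).
    assert (0 <= Rabs x * / b * INR m)
      by (repeat apply Rmult_le_pos; try lra; left; now apply Rinv_0_lt_compat).
    lra.
Qed.

Lemma is_pseries_pFq_1_1 (x b z : R) :
  0 < b ->
  is_pseries (fun m => (-1) ^ m * (poch (- x) m / poch b m) / INR (fact m)) z
    (pFq (- x :: nil) (b :: nil) (- z)).
Proof.
  intros Hb; apply is_pseries_iff; unfold pFq.
  apply is_series_ext with (hyp_term (- x :: nil) (b :: nil) (- z)).
  { intros m; unfold hyp_term; simpl; rewrite !Rmult_1_r.
    replace (- z) with (-1 * z) by ring; rewrite Rpow_mult_distr.
    pose proof (poch_pos b m Hb); pose proof (INR_fact_lt_0 m); field; lra. }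
  apply Series_correct.
  apply (ex_series_le (K := R_AbsRing) (V := R_CompleteNormedModule) _
    (fun m => / INR (fact m) * ((1 + Rabs (- x) / b) * Rabs z) ^ m)).
  - intros m; change (Rabs (hyp_term (- x :: nil) (b :: nil) (- z) m)
      <= / INR (fact m) * ((1 + Rabs (- x) / b) * Rabs z) ^ m).
    unfold hyp_term; simpl; rewrite !Rmult_1_r.
    pose proof (INR_fact_lt_0 m) as Hf.
    unfold Rdiv at 1; rewrite !Rabs_mult, <- RPow_abs, Rabs_Ropp.
    rewrite (Rabs_right (/ INR (fact m))) by (left; now apply Rinv_0_lt_compat).
    rewrite (Rmult_comm (/ INR (fact m))), Rpow_mult_distr.
    apply Rmult_le_compat_r; [left; now apply Rinv_0_lt_compat|].
    apply Rmult_le_compat_r; [apply pow_le, Rabs_pos|].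
    now apply Rabs_poch_ratio_le.
  - eexists; apply is_series_exp.
Qed.

Lemma poch_opp_INR_fact (n k : nat) :
  (k <= n)%nat -> poch (- INR n) k * INR (fact (n - k)) = (-1) ^ k * INR (fact n).
Proof.
  revert n; induction k as [|k IH]; intros n Hk.
  - rewrite Nat.sub_0_r; simpl; ring.
  - destruct n as [|n]; [lia|].
    rewrite poch_opp_S, Nat.sub_succ, fact_simpl, mult_INR; simpl pow.
    rewrite Rmult_assoc, IH by lia; ring.
Qed.

(** Coefficient of z^n in 1F1(b+x; b; z), which is e^z 1F1(-x; b; -z) by Kummer's transformation. In
    this form it is a multiple of (b+x)_n, the weight that the lowering relation absorbs at x =
    k. *)
Definition kummer_poly (b x : R) (n : nat) : R :=
  poch (b + x) n / (poch b n * INR (fact n)).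

(** Kummer's transformation, coefficient by coefficient: the Cauchy product is a Chu-Vandermonde
    sum. *)
Lemma kummer_poly_PS_mult (b x : R) (n : nat) :
  0 < b ->
  PS_mult (fun m => (-1) ^ m * (poch (- x) m / poch b m) / INR (fact m))
    (fun m => / INR (fact m)) n = kummer_poly b x n.
Proof.
  intros Hb; unfold PS_mult, kummer_poly.
  rewrite (sum_eq _ (fun l => poch (- INR n) l * poch (- x) l / (INR (fact l) * poch b l)
                              * / INR (fact n))).
  - rewrite <- scal_sum, chu_vandermonde by exact Hb.
    replace (b - - x) with (b + x) by ring.
    pose proof (poch_pos b n Hb); pose proof (INR_fact_lt_0 n); field; lra.
  - intros l Hl; pose proof (poch_opp_INR_fact n l Hl) as H.
    pose proof (poch_pos b l Hb); pose proof (INR_fact_lt_0 n); pose proof (INR_fact_lt_0 l).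
    pose proof (INR_fact_lt_0 (n - l)).
    replace (poch (- INR n) l) with ((-1) ^ l * INR (fact n) / INR (fact (n - l)))
      by (rewrite <- H; field; lra).
    field; lra.
Qed.

Definition meixner_coef (b rho : R) (r : nat) (n : nat) (x : R) : R :=
  sum_f_R0 (fun a => exp_pow_coef rho r a * kummer_poly b x (n - a)) n.

(** For fixed x all series are entire in z, so Cauchy products are legitimate and the coefficients
    are determined. *)
Lemma meixner_coef_of_gf (b rho : R) (r : nat) (x : R) (m : nat -> R) (n : nat) :
  0 < b -> (1 <= r)%nat ->
  (forall z, is_series (fun n => m n * z ^ n / INR (fact n))
     (exp (z + rho * z ^ r) * pFq (- x :: nil) (b :: nil) (- z))) ->
  m n = INR (fact n) * meixner_coef b rho r n x.
Proof.
  intros Hb Hr Hm.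
  assert (HK : forall z, is_pseries (kummer_poly b x) z
     (pFq (- x :: nil) (b :: nil) (- z) * exp z)).
  { intros z; eapply is_pseries_ext; [intros k; now apply kummer_poly_PS_mult|].
    apply is_pseries_mult_entire.
    - intros y; eexists; now apply is_pseries_pFq_1_1.
    - intros y; eexists; apply is_exp_Reals.
    - now apply is_pseries_pFq_1_1.
    - apply is_exp_Reals. }
  assert (H : m n / INR (fact n) = PS_mult (exp_pow_coef rho r) (kummer_poly b x) n).
  { apply (is_pseries_entire_unique (fun n => m n / INR (fact n)) _
      (fun z => exp (rho * z ^ r) * (pFq (- x :: nil) (b :: nil) (- z) * exp z))).
    - intros z; apply is_pseries_iff.
      replace (exp (rho * z ^ r) * (pFq (- x :: nil) (b :: nil) (- z) * exp z))
        with (exp (z + rho * z ^ r) * pFq (- x :: nil) (b :: nil) (- z))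
        by (rewrite exp_plus; ring).
      eapply is_series_ext; [|apply Hm]; intros k; change (m k * z ^ k / INR (fact k) = m k / INR (fact k) * z ^ k); unfold Rdiv; ring.
    - intros z; apply is_pseries_mult_entire.
      + intros y; eexists; now apply is_pseries_exp_pow.
      + intros y; eexists; apply HK.
      + now apply is_pseries_exp_pow.
      + apply HK. }
  unfold meixner_coef; fold (PS_mult (exp_pow_coef rho r) (kummer_poly b x) n).
  rewrite <- H; field; apply INR_fact_neq_0.
Qed.

Lemma sum_f_R0_skip (f : nat -> R) (r n : nat) :
  (forall a, (a < r)%nat -> f a = 0) ->
  sum_f_R0 f (r + n) = sum_f_R0 (fun a => f (r + a)%nat) n.
Proof.
  intros Hf; induction n as [|n IH].
  - rewrite Nat.add_0_r; simpl; rewrite Nat.add_0_r.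
    destruct r as [|r]; [easy|].
    rewrite tech5, (sum_eq _ (fun _ => 0)), sum_cte by (intros; apply Hf; lia); ring.
  - rewrite Nat.add_succ_r, !tech5, IH, Nat.add_succ_r; easy.
Qed.

(** Coefficient of z^n in z^k times the series of [u]; the test gives 0 where natural subtraction
    would truncate. *)
Definition shifted (u : nat -> R) (k n : nat) : R := if Nat.leb k n then u (n - k)%nat else 0.

(** The Euler operator z d/dz acts on exp (rho z^r) as multiplication by r rho z^r, so a factor a in
    the convolution becomes a shift by r. *)
Lemma sum_mult_exp_pow_coef (rho : R) (r n : nat) (g : nat -> R) :
  (1 <= r)%nat ->
  sum_f_R0 (fun a => INR a * exp_pow_coef rho r a * g a) n =
  INR r * rho * shifted (fun n => sum_f_R0 (fun a => exp_pow_coef rho r a * g (r + a)%nat) n) r n.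
Proof.
  intros Hr; unfold shifted.
  assert (H0 : forall a, (a < r)%nat -> INR a * exp_pow_coef rho r a * g a = 0).
  { intros [|a] Ha; [simpl; ring|].
    rewrite exp_pow_coef_small by lia; ring. }
  destruct (Nat.leb_spec r n) as [Hn|Hn].
  - replace n with (r + (n - r))%nat at 1 by lia.
    rewrite sum_f_R0_skip, scal_sum by exact H0.
    apply sum_eq; intros a _; rewrite Nat.add_comm, exp_pow_coef_add, Nat.add_comm by exact Hr; ring.
  - rewrite (sum_eq _ (fun _ => 0)), sum_cte by (intros; apply H0; lia); ring.
Qed.

Lemma kummer_poly_S (b x : R) (n : nat) :
  0 < b ->
  x * kummer_poly b x n =
  INR (S n) * (INR n + b) * kummer_poly b x (S n) - (INR n + b) * kummer_poly b x n.
Proof.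
  intros Hb; unfold kummer_poly; rewrite fact_simpl, mult_INR, S_INR; simpl poch.
  pose proof (poch_pos b n Hb); pose proof (INR_fact_lt_0 n); pose proof (pos_INR n).
  field; repeat split; lra.
Qed.

(** Inside the convolution, [kummer_poly_S] at n - a has the coefficient (n+1-a)(n-a+b) = (n+1)(n+b)
    - (2n+1+b) a + a^2. Each factor a is traded for a shift by r, so a^2 produces the shift by 2r
    and the coefficient (r rho)^2. *)
Lemma meixner_recurrence (b rho : R) (r n : nat) (x : R) :
  0 < b -> (1 <= r)%nat ->
  x * meixner_coef b rho r n x =
  INR (S n) * (INR n + b) * meixner_coef b rho r (S n) x
  - (INR n + b) * meixner_coef b rho r n x
  + INR r * rho * shifted (fun n => meixner_coef b rho r n x) r n
  + INR r * rho * (INR r - (2 * INR n + 1 + b)) * shifted (fun n => meixner_coef b rho r n x) r (S n)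
  + (INR r * rho) ^ 2 * shifted (fun n => meixner_coef b rho r n x) (2 * r) (S n).
Proof.
  intros Hb Hr.
  set (e := exp_pow_coef rho r); set (P := kummer_poly b x).
  assert (Hconv : forall N (g : nat -> R), (forall a, (a <= N - r)%nat -> g (r + a)%nat = P (N - r - a)%nat) ->
    sum_f_R0 (fun a => INR a * e a * g a) N
    = INR r * rho * shifted (fun n => meixner_coef b rho r n x) r N).
  { intros N g Hg; unfold e; rewrite sum_mult_exp_pow_coef by exact Hr; f_equal.
    unfold shifted, meixner_coef; destruct (Nat.leb_spec r N); [|easy].
    apply sum_eq; intros a Ha; rewrite Hg by lia; easy. }
  assert (Hsq : sum_f_R0 (fun a => INR a * e a * (INR a * P (S n - a)%nat)) (S n) =
    INR r * rho * (INR r * shifted (fun n => meixner_coef b rho r n x) r (S n)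
      + INR r * rho * shifted (fun n => meixner_coef b rho r n x) (2 * r) (S n))).
  { unfold e; rewrite sum_mult_exp_pow_coef by exact Hr; fold e; f_equal.
    unfold shifted at 1 2; destruct (Nat.leb_spec r (S n)) as [Hn|Hn].
    - rewrite (sum_eq _ (fun a => e a * P (S n - r - a)%nat * INR r
                               + INR a * e a * P (S n - r - a)%nat)).
      + rewrite plus_sum, <- scal_sum; f_equal.
        rewrite (Hconv (S n - r)%nat (fun a => P (S n - r - a)%nat))
          by (intros a Ha; apply (f_equal P); lia).
        f_equal; unfold shifted.
        destruct (Nat.leb_spec r (S n - r)); destruct (Nat.leb_spec (2 * r) (S n)); try lia; [|easy].
        f_equal; lia.
      + intros a Ha; rewrite plus_INR; replace (S n - (r + a))%nat with (S n - r - a)%nat by lia; ring.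
    - unfold shifted; destruct (Nat.leb_spec (2 * r) (S n)); [lia | ring]. }
  assert (H1 := Hconv (S n) (fun a => P (S n - a)%nat)
    (fun a _ => f_equal P (Nat.sub_add_distr (S n) r a))).
  assert (H2 := Hconv n (fun a => P (n - a)%nat)
    (fun a _ => f_equal P (Nat.sub_add_distr n r a))).
  cbv beta in H1, H2.
  transitivity (
    (INR (S n) * (INR n + b) * meixner_coef b rho r (S n) x
     - (2 * INR n + 1 + b) * sum_f_R0 (fun a => INR a * e a * P (S n - a)%nat) (S n)
     + sum_f_R0 (fun a => INR a * e a * (INR a * P (S n - a)%nat)) (S n))
    - ((INR n + b) * meixner_coef b rho r n x - sum_f_R0 (fun a => INR a * e a * P (n - a)%nat) n)).
  - unfold meixner_coef; fold e P.
    rewrite (scal_sum _ (S n)), (scal_sum _ (S n)), <- minus_sum, <- plus_sum.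
    rewrite (sum_eq _ (fun a => e a * ((INR (S n) - INR a) * (INR n - INR a + b) * P (S n - a)%nat)) (S n))
      by (intros; rewrite S_INR; ring).
    (* The term a = n + 1 has the factor n + 1 - a = 0, which reconciles the ranges n and n + 1. *)
    rewrite tech5, Rminus_diag, !Rmult_0_l, Rmult_0_r, Rplus_0_r.
    rewrite !scal_sum, <- !minus_sum.
    apply sum_eq; intros a Ha.
    pose proof (kummer_poly_S b x (n - a) Hb) as HS; fold P in HS.
    replace (S n - a)%nat with (S (n - a)) by lia.
    rewrite S_INR, minus_INR in HS by exact Ha; rewrite S_INR.
    transitivity (e a * (x * P (n - a)%nat)); [ring|]; rewrite HS; ring.
  - rewrite H1, H2, Hsq; ring.
Qed.

(** * The hypergeometric weights *)

Lemma Series_finite (h : nat -> R) (N : nat) :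
  (forall m, (N <= m)%nat -> h m = 0) -> Series h = psum h N.
Proof.
  intros Hh; apply is_series_unique, is_series_of_psum.
  apply is_lim_seq_ext_loc with (fun _ => psum h N); [|apply is_lim_seq_const].
  exists N; intros n Hn; induction Hn as [|n Hn IH]; [easy|].
  cbn [psum]; rewrite <- IH, Hh by exact Hn; ring.
Qed.

Lemma psum_ext (f g : nat -> R) (n : nat) :
  (forall k, (k < n)%nat -> f k = g k) -> psum f n = psum g n.
Proof.
  induction n as [|n IH]; intros H; [easy|].
  cbn [psum]; rewrite IH, H by (intros; try apply H; lia); easy.
Qed.

Lemma psum_add (f g : nat -> R) (n : nat) :
  psum (fun k => f k + g k) n = psum f n + psum g n.
Proof. induction n as [|n IH]; cbn [psum]; [ring | rewrite IH; ring]. Qed.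

Lemma psum_scal (x : R) (f : nat -> R) (n : nat) : psum (fun k => x * f k) n = x * psum f n.
Proof. induction n as [|n IH]; cbn [psum]; [ring | rewrite IH; ring]. Qed.

Lemma psum_cat (f : nat -> R) (n p : nat) :
  psum f (n + p) = psum f n + psum (fun s => f (n + s)%nat) p.
Proof.
  induction p as [|p IH]; [rewrite Nat.add_0_r; simpl; ring|].
  rewrite Nat.add_succ_r; cbn [psum]; rewrite IH; ring.
Qed.

(** Each l < rK is s + r m for unique s < r and m < K; this merges the r hypergeometric series of a
    weight into one sum over l. *)
Lemma psum_blocks (T : nat -> R) (r K : nat) :
  psum (fun s => psum (fun m => T (s + r * m)%nat) K) r = psum T (r * K).
Proof.
  induction K as [|K IH].
  - rewrite Nat.mul_0_r; simpl; rewrite (psum_ext _ (fun _ => 0 * 0)) by (intros; ring).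
    rewrite psum_scal; ring.
  - cbn [psum]; rewrite psum_add, IH, Nat.mul_succ_r, psum_cat; f_equal.
    apply psum_ext; intros s _; f_equal; lia.
Qed.

Lemma prod_app (s t : list R) :
  fold_right Rmult 1 (s ++ t) = fold_right Rmult 1 s * fold_right Rmult 1 t.
Proof. induction s as [|x s IH]; simpl; [ring | rewrite IH; ring]. Qed.

Lemma poch_1 (m : nat) : poch 1 m = INR (fact m).
Proof.
  induction m as [|m IH]; [easy|].
  rewrite fact_simpl, mult_INR, S_INR; simpl poch; rewrite IH; ring.
Qed.

Lemma fact_mult_poch (s p : nat) : INR (fact s) * poch (INR s + 1) p = INR (fact (s + p)).
Proof. rewrite <- !poch_1, poch_add; f_equal; f_equal; ring. Qed.

Definition weight_summand (b c : R) (r i k l : nat) : R :=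
  poch (- INR k) l / (INR (fact l) * poch b l) * Rpower (1 - c) (INR l / INR r)
  * Gamma ((b + INR i + INR l) / INR r).

(** Gauss multiplication turns the lists into symbols of length rm, which extend (-k)_s, (b)_s and
    s! of the prefactor to s + rm. The upper parameter 1 cancels m!, and the last upper parameter is
    absorbed by Gamma. *)
Lemma weight_block (b c : R) (r i k s : nat) :
  0 < b -> 0 < c < 1 -> (1 <= r)%nat ->
  poch (- INR k) s * Rpower (1 - c) (INR s / INR r) / (INR (fact s) * poch b s)
  * Gamma ((b + INR i + INR s) / INR r)
  * pFq (1 :: Defs.Delta r (- INR k + INR s) ++ ((b + INR s + INR i) / INR r) :: nil)
        (Defs.Delta r (b + INR s) ++ Defs.Delta r (INR s + 1)) ((1 - c) / INR r ^ r)
  = psum (fun m => weight_summand b c r i k (s + r * m)) (S k).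
Proof.
  intros Hb Hc Hr.
  assert (HrR : 1 <= INR r) by (apply (le_INR 1); exact Hr).
  pose proof (pos_INR i); pose proof (pos_INR s).
  assert (Hpos : 0 < (b + INR i + INR s) / INR r) by (apply Rdiv_lt_0_compat; lra).
  assert (Hterm : forall m, hyp_term
      (1 :: Defs.Delta r (- INR k + INR s) ++ ((b + INR s + INR i) / INR r) :: nil)
      (Defs.Delta r (b + INR s) ++ Defs.Delta r (INR s + 1)) ((1 - c) / INR r ^ r) m
      = poch (- INR k + INR s) (r * m) * poch ((b + INR i + INR s) / INR r) m
        / (poch (b + INR s) (r * m) * poch (INR s + 1) (r * m)) * (1 - c) ^ m).
  { intros m; unfold hyp_term.
    cbn [map fold_right]; rewrite !map_app, !prod_app; cbn [map fold_right].
    rewrite poch_1, <- !(poch_Delta r _ m Hr).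
    replace (b + INR s + INR i) with (b + INR i + INR s) by ring.
    replace (((1 - c) / INR r ^ r) ^ m) with ((1 - c) ^ m / INR r ^ (r * m))
      by (unfold Rdiv; rewrite Rpow_mult_distr, pow_inv, <- pow_mult; easy).
    assert (0 < INR r ^ (r * m)) by (apply pow_lt; lra).
    pose proof (INR_fact_lt_0 m).
    assert (Hn1 : poch (b + INR s) (r * m) <> 0) by (apply Rgt_not_eq, poch_pos; lra).
    assert (Hn2 : poch (INR s + 1) (r * m) <> 0) by (apply Rgt_not_eq, poch_pos; lra).
    rewrite <- (poch_Delta r _ m Hr) in Hn1; rewrite <- (poch_Delta r _ m Hr) in Hn2.
    apply Rmult_neq_0_reg in Hn1; apply Rmult_neq_0_reg in Hn2.
    field; intuition lra. }
  assert (Hmul : forall m,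
    poch (- INR k) s * Rpower (1 - c) (INR s / INR r) / (INR (fact s) * poch b s)
    * Gamma ((b + INR i + INR s) / INR r)
    * (poch (- INR k + INR s) (r * m) * poch ((b + INR i + INR s) / INR r) m
        / (poch (b + INR s) (r * m) * poch (INR s + 1) (r * m)) * (1 - c) ^ m)
    = weight_summand b c r i k (s + r * m)).
  { intros m; unfold weight_summand.
    rewrite <- fact_mult_poch, !poch_add, plus_INR, mult_INR.
    replace ((INR s + INR r * INR m) / INR r) with (INR s / INR r + INR m) by (field; lra).
    replace ((b + INR i + (INR s + INR r * INR m)) / INR r)
      with ((b + INR i + INR s) / INR r + INR m) by (field; lra).
    rewrite Gamma_add, Rpower_plus, Rpower_pow by lra.
    pose proof (INR_fact_lt_0 s); pose proof (poch_pos b s Hb).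
    assert (0 < poch (b + INR s) (r * m)) by (apply poch_pos; lra).
    assert (0 < poch (INR s + 1) (r * m)) by (apply poch_pos; lra).
    field; lra. }
  (* For s > k the upper parameters are positive and the series does not terminate; but then the
     prefactor (-k)_s is 0, as is every (-k)_(s+rm). *)
  destruct (Nat.le_gt_cases s k) as [Hs|Hs].
  - unfold pFq; rewrite (Series_finite _ (S k)).
    + rewrite <- psum_scal; apply psum_ext; intros m _; rewrite Hterm; apply Hmul.
    + intros m Hm; rewrite Hterm.
      replace (- INR k + INR s) with (- INR (k - s)) by (rewrite minus_INR by exact Hs; ring).
      rewrite poch_opp_INR_0 by nia; unfold Rdiv; ring.
  - rewrite poch_opp_INR_0 by exact Hs.
    rewrite (psum_ext _ (fun _ => 0 * 0)).
    + rewrite psum_scal; unfold Rdiv; ring.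
    + intros m _; unfold weight_summand; rewrite poch_opp_INR_0 by lia; unfold Rdiv; ring.
Qed.

(** The blocks cover all l <= k, and (-k)_l = 0 beyond. The powers of 1 - c are powers of 1/lam and
    combine with Gamma into the moment of order i + l. *)
Lemma w_weight_laguerre (b c : R) (r i k : nat) :
  0 < b -> 0 < c < 1 -> (1 <= r)%nat ->
  w_weight r b c i k * poch b k / INR (fact k) =
  (-1) ^ i / (Gamma b * sqrt (INR (fact i) * poch b i))
  * laguerre_functional b (moment b (/ (1 - c)) r) k i.
Proof.
  intros Hb Hc Hr; unfold w_weight.
  assert (HrR : 1 <= INR r) by (apply (le_INR 1); exact Hr).
  rewrite <- sum_n_Reals, <- psum_S; replace (S (r - 1)) with r by lia.
  rewrite (psum_ext _ (fun s => psum (fun m => weight_summand b c r i k (s + r * m)) (S k)))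
    by (intros s _; now apply weight_block).
  rewrite psum_blocks; replace (r * S k)%nat with (S (r * k + r - 1)) by lia.
  rewrite psum_S, sum_n_Reals, (sum_f_R0_extend _ k) by
    (nia || (intros l Hl; unfold weight_summand; rewrite poch_opp_INR_0 by lia; unfold Rdiv; ring)).
  unfold laguerre_functional.
  pose proof (Gamma_pos b Hb); pose proof (INR_fact_lt_0 k).
  assert (0 < sqrt (INR (fact i) * poch b i))
    by (apply sqrt_lt_R0, Rmult_lt_0_compat; [apply INR_fact_lt_0 | now apply poch_pos]).
  unfold Rdiv at 1; rewrite Rmult_assoc, !(Rmult_comm _ (sum_f_R0 _ k)), Rmult_assoc.
  rewrite !(Rmult_comm (sum_f_R0 _ k)), !scal_sum.
  apply sum_eq; intros l _; unfold weight_summand, laguerre_coef, moment.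
  rewrite plus_INR, <- Rplus_assoc.
  replace (Rpower (/ (1 - c)) (- ((b + INR i + INR l) / INR r)))
    with (Rpower (1 - c) ((b + INR i) / INR r) * Rpower (1 - c) (INR l / INR r)).
  - pose proof (poch_pos b l Hb); pose proof (INR_fact_lt_0 l); field; lra.
  - rewrite <- Rpower_plus; unfold Rpower; rewrite ln_Rinv by lra; f_equal; field; lra.
Qed.

(** * Orthogonality *)

(** The operator z d/dz - j applied to z^j exp (s z^r). For j <= n < j + r only n = j has a nonzero
    coefficient, and there the factor n - j is 0. *)
Lemma shifted_exp_pow_coef (s : R) (r n j : nat) :
  (1 <= r)%nat ->
  (INR n - INR j) * shifted (exp_pow_coef s r) j n =
  INR r * s * shifted (exp_pow_coef s r) (j + r) n.
Proof.
  intros Hr; unfold shifted.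
  destruct (Nat.leb_spec j n); destruct (Nat.leb_spec (j + r) n); try lia; [| |ring].
  - rewrite <- minus_INR by assumption.
    replace (n - j)%nat with ((n - (j + r)) + r)%nat by lia.
    now rewrite exp_pow_coef_add.
  - destruct (Nat.eq_dec n j) as [->|Hne]; [ring|].
    rewrite exp_pow_coef_small by lia; ring.
Qed.

(** The value predicted by evaluation at 0: S (exp (-lam u^r)) times (-1)^n n! (b)_n times the
    coefficient of u^n in u^j exp (-lam u^r). The sign (-1)^n replaces u by -z, whence (-1)^j and
    the (-1)^r beside lam. The proof checks this candidate against the recurrence in n. *)
Lemma poch_series_closed (b lam : R) (r n j : nat) :
  0 < b -> 1 <= lam -> (1 <= r)%nat ->
  poch_series b lam r n j =
  poch_series b lam r 0 0 * (INR (fact n) * poch b n)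
  * ((-1) ^ j * shifted (exp_pow_coef (- ((-1) ^ r * lam)) r) j n).
Proof.
  intros Hb Hlam Hr; revert j.
  set (s := - ((-1) ^ r * lam)).
  induction n as [|n IH]; intros j.
  - destruct j as [|j].
    + unfold shifted; simpl; rewrite exp_pow_coef_0 by exact Hr; ring.
    + unfold poch_series at 1, shifted; simpl poch; simpl Nat.leb.
      rewrite (Series_ext _ (fun k => laguerre_functional b (moment b lam r) k (S j)))
        by (intros; ring).
      rewrite Series_laguerre_functional_S by assumption; ring.
  - rewrite poch_series_S, !IH by assumption.
    assert (Hls : (-1) ^ r * lam = - s) by (unfold s; ring).
    assert (Hl2 : lam ^ 2 = s ^ 2).
    { transitivity (((-1) ^ r * (-1) ^ r) * lam ^ 2); [|unfold s; ring].
      rewrite <- Rpow_mult_distr; replace (-1 * -1) with 1 by ring; rewrite pow1; ring. }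
    set (E := shifted (exp_pow_coef s r)).
    assert (Hd : forall n j, (INR n - INR j) * E j n = INR r * s * E (j + r)%nat n)
      by (intros; now apply shifted_exp_pow_coef).
    rewrite fact_simpl, mult_INR; simpl poch.
    set (S0 := poch_series b lam r 0 0).
    set (F := INR (fact n) * poch b n).
    (* For j = 0 the term in [pred j] drops out, and the coefficient equation is used at (n + 1, 0)
       and at (n, r - 1). *)
    destruct j as [|j].
    + replace (0 + 2 * r - 1)%nat with ((r - 1) + r)%nat by lia.
      replace (0 + r - 1)%nat with (r - 1)%nat by lia.
      pose proof (Hd (S n) 0%nat) as H0; change (INR 0) with 0 in H0.
      replace (0 + r)%nat with (S (r - 1)) in H0 by lia.
      change (E (S (r - 1)) (S n)) with (E (r - 1)%nat n) in H0.
      pose proof (Hd n (r - 1)%nat) as H1; rewrite minus_INR in H1 by lia; change (INR 1) with 1 in H1.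
      assert (Hp : (-1) ^ r = - (-1) ^ (r - 1))
        by (replace r with (S (r - 1)) at 1 by lia; simpl; ring).
      assert (Hq : (-1) ^ (r - 1 + r) = -1).
      { rewrite pow_add, Hp.
        transitivity (- ((-1) ^ (r - 1) * (-1) ^ (r - 1))); [ring|].
        rewrite <- Rpow_mult_distr; replace (-1 * -1) with 1 by ring; rewrite pow1; ring. }
      rewrite Hq; change (INR 0) with 0.
      transitivity (S0 * F * (INR r * (b + INR r - 1) * (((-1) ^ (r - 1) * lam) * E (r - 1)%nat n)
        + (INR r) ^ 2 * lam ^ 2 * E (r - 1 + r)%nat n)); [ring|].
      replace ((-1) ^ (r - 1) * lam) with s by (unfold s; rewrite Hp; ring).
      rewrite Hl2.
      transitivity (S0 * F * ((b + INR r - 1) * (INR r * s * E (r - 1)%nat n)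
        + INR r * s * (INR r * s * E (r - 1 + r)%nat n))); [ring|].
      rewrite <- H1.
      transitivity (S0 * F * (INR n + b) * (INR r * s * E (r - 1)%nat n)); [ring|].
      rewrite <- H0; unfold F; simpl; ring.
    + replace (S j + 2 * r - 1)%nat with ((j + r) + r)%nat by lia.
      replace (S j + r - 1)%nat with (j + r)%nat by lia.
      change (E (S j) (S n)) with (E j n); simpl pred.
      pose proof (Hd n j) as H0; pose proof (Hd n (j + r)%nat) as H1.
      rewrite plus_INR in H1.
      assert (Hq : (-1) ^ (j + r + r) = (-1) ^ j).
      { rewrite !pow_add, Rmult_assoc.
        rewrite <- Rpow_mult_distr; replace (-1 * -1) with 1 by ring; rewrite pow1; ring. }
      rewrite Hq, pow_add.
      transitivity (S0 * F * (-1) ^ j * (- (INR (S j) * (INR (S j) + b - 1) * E j n)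
        + INR r * (2 * INR (S j) + b + INR r - 1) * (((-1) ^ r * lam) * E (j + r)%nat n)
        - (INR r) ^ 2 * lam ^ 2 * E (j + r + r)%nat n)); [ring|].
      rewrite Hls, Hl2.
      transitivity (S0 * F * (-1) ^ j * (- (INR (S j) * (INR (S j) + b - 1) * E j n)
        - (2 * INR (S j) + b + INR r - 1) * (INR r * s * E (j + r)%nat n)
        - INR r * s * (INR r * s * E (j + r + r)%nat n))); [ring|].
      rewrite <- H1.
      transitivity (S0 * F * (-1) ^ j * (- (INR (S j) * (INR (S j) + b - 1) * E j n)
        - (2 * INR (S j) + b + INR r - 1 + (INR n - (INR j + INR r))) * (INR r * s * E (j + r)%nat n)));
        [ring|].
      rewrite <- H0; unfold F; rewrite !S_INR; simpl pow; ring.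
Qed.

(** exp (rho z^r) exp (-rho z^r) = 1, with 1 taken as exp (0 z^r) so that its coefficients fall
    under the same definition. *)
Lemma exp_pow_coef_conv (rho : R) (r N : nat) :
  (1 <= r)%nat -> (0 < N)%nat ->
  sum_f_R0 (fun a => exp_pow_coef rho r a * exp_pow_coef (- rho) r (N - a)) N = 0.
Proof.
  intros Hr HN.
  transitivity (exp_pow_coef 0 r N).
  - apply (is_pseries_entire_unique (PS_mult (exp_pow_coef rho r) (exp_pow_coef (- rho) r))
             (exp_pow_coef 0 r) (fun z => exp (0 * z ^ r))).
    + intros z; replace (exp (0 * z ^ r)) with (exp (rho * z ^ r) * exp (- rho * z ^ r))
        by (rewrite <- exp_plus; f_equal; ring).
      apply is_pseries_mult_entire.
      * intros y; eexists; now apply is_pseries_exp_pow.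
      * intros y; eexists; now apply is_pseries_exp_pow.
      * now apply is_pseries_exp_pow.
      * now apply is_pseries_exp_pow.
    + intros z; now apply is_pseries_exp_pow.
  - unfold exp_pow_coef; destruct (Nat.eqb_spec (N mod r) 0) as [H0|]; [|easy].
    pose proof (Nat.div_mod_eq N r); rewrite H0 in *.
    rewrite pow_i by (destruct (N / r)%nat; lia); unfold Rdiv; ring.
Qed.

(** * The functionals on polynomials in k *)

Lemma poly_growth_sum (f : nat -> nat -> R) (n : nat) :
  (forall a, (a <= n)%nat -> poly_growth (f a)) ->
  poly_growth (fun k => sum_f_R0 (fun a => f a k) n).
Proof.
  induction n as [|n IH]; intros H; simpl; [now apply H|].
  apply poly_growth_plus; [apply IH; intros; apply H; lia | now apply H].
Qed.

Lemma poly_growth_kummer_poly (b : R) (n : nat) :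
  poly_growth (fun k => kummer_poly b (INR k) n).
Proof.
  apply poly_growth_mult; [apply poly_growth_poch | apply poly_growth_const].
Qed.

Lemma poly_growth_meixner_coef (b rho : R) (r n : nat) :
  poly_growth (fun k => meixner_coef b rho r n (INR k)).
Proof.
  apply (poly_growth_sum (fun a k => exp_pow_coef rho r a * kummer_poly b (INR k) (n - a))).
  intros a _; apply poly_growth_mult; [apply poly_growth_const | apply poly_growth_kummer_poly].
Qed.

Lemma poly_growth_pow (m : nat) : poly_growth (fun k => INR k ^ m).
Proof.
  induction m as [|m IH]; [apply (poly_growth_const 1)|].
  simpl; apply poly_growth_mult; [apply poly_growth_INR | exact IH].
Qed.

Lemma poly_growth_is_poly (f : R -> R) : is_poly f -> poly_growth (fun k => f (INR k)).
Proof.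
  intros (n & a & _ & Hf).
  eapply poly_growth_ext; [intros k; symmetry; apply Hf|].
  apply (poly_growth_sum (fun j k => a j * INR k ^ j)); intros j _.
  apply poly_growth_mult; [apply poly_growth_const | apply poly_growth_pow].
Qed.

(** L_i without its nonzero constant; the index of the Laguerre polynomial is the point where [f] is
    evaluated. *)
Definition laguerre_pairing (b lam : R) (r i : nat) (f : R -> R) : R :=
  Series (fun k => f (INR k) * laguerre_functional b (moment b lam r) k i).

Section Pairing.

Context (b lam : R) (r i : nat) (Hb : 0 < b) (Hlam : 1 <= lam) (Hr : (1 <= r)%nat).

Lemma ex_laguerre_pairing (f : R -> R) :
  poly_growth (fun k => f (INR k)) ->
  ex_series (fun k => f (INR k) * laguerre_functional b (moment b lam r) k i).
Proof.
  intros Hf; apply rapidly_decreasing_ex_series, rapidly_decreasing_mult; [exact Hf|].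
  now apply rapidly_decreasing_laguerre_functional.
Qed.

Lemma laguerre_pairing_ext (f g : R -> R) :
  (forall x, f x = g x) -> laguerre_pairing b lam r i f = laguerre_pairing b lam r i g.
Proof. intros H; apply Series_ext; intros k; now rewrite H. Qed.

Lemma laguerre_pairing_plus (f g : R -> R) :
  poly_growth (fun k => f (INR k)) -> poly_growth (fun k => g (INR k)) ->
  laguerre_pairing b lam r i (fun x => f x + g x) =
  laguerre_pairing b lam r i f + laguerre_pairing b lam r i g.
Proof.
  intros Hf Hg; unfold laguerre_pairing.
  rewrite <- Series_plus by now apply ex_laguerre_pairing.
  apply Series_ext; intros k; ring.
Qed.

Lemma laguerre_pairing_scal (a : R) (f : R -> R) :
  laguerre_pairing b lam r i (fun x => a * f x) = a * laguerre_pairing b lam r i f.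
Proof.
  unfold laguerre_pairing; rewrite <- Series_scal_l; apply Series_ext; intros k; ring.
Qed.

Lemma laguerre_pairing_sum (f : nat -> R -> R) (n : nat) :
  (forall a, (a <= n)%nat -> poly_growth (fun k => f a (INR k))) ->
  laguerre_pairing b lam r i (fun x => sum_f_R0 (fun a => f a x) n) =
  sum_f_R0 (fun a => laguerre_pairing b lam r i (f a)) n.
Proof.
  induction n as [|n IH]; intros H; [easy|].
  cbn [sum_f_R0]; rewrite laguerre_pairing_plus, IH; [easy | | |].
  - intros; apply H; lia.
  - apply (poly_growth_sum (fun a k => f a (INR k))); intros; apply H; lia.
  - now apply H.
Qed.

Lemma laguerre_pairing_kummer_poly (n : nat) :
  laguerre_pairing b lam r i (fun x => kummer_poly b x n) =
  poch_series b lam r 0 0 * (-1) ^ i * shifted (exp_pow_coef (- ((-1) ^ r * lam)) r) i n.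
Proof.
  rewrite (laguerre_pairing_ext _ (fun x => / (poch b n * INR (fact n)) * poch (b + x) n))
    by (intros x; apply Rmult_comm).
  rewrite laguerre_pairing_scal.
  change (laguerre_pairing b lam r i (fun x => poch (b + x) n)) with (poch_series b lam r n i).
  rewrite poch_series_closed by assumption.
  pose proof (poch_pos b n Hb); pose proof (INR_fact_lt_0 n); field; lra.
Qed.

(** The values on [kummer_poly] are the coefficients of S0 (-z)^i exp (-rho z^r), where S0 is
    [poch_series b lam r 0 0]; convolution with exp (rho z^r) leaves S0 (-z)^i. *)
Lemma laguerre_pairing_meixner (N : nat) :
  laguerre_pairing b lam r i (meixner_coef b ((-1) ^ r * lam) r (N + i)) =
  poch_series b lam r 0 0 * (-1) ^ i * (if Nat.eqb N 0 then 1 else 0).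
Proof.
  set (rho := (-1) ^ r * lam).
  unfold meixner_coef.
  rewrite laguerre_pairing_sum.
  - rewrite (sum_eq _ (fun a => exp_pow_coef rho r a * shifted (exp_pow_coef (- rho) r) i (N + i - a)
                            * (poch_series b lam r 0 0 * (-1) ^ i))).
    + rewrite <- scal_sum; f_equal.
      rewrite (sum_f_R0_extend _ N) by
        (lia || (intros a Ha; unfold shifted; destruct (Nat.leb_spec i (N + i - a)); [lia | ring])).
      rewrite (sum_eq _ (fun a => exp_pow_coef rho r a * exp_pow_coef (- rho) r (N - a))).
      * destruct N as [|N]; [simpl; rewrite !exp_pow_coef_0 by exact Hr; ring|].
        rewrite exp_pow_coef_conv by lia; easy.
      * intros a Ha; unfold shifted; destruct (Nat.leb_spec i (N + i - a)); [|lia].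
        do 2 f_equal; lia.
    + intros a _; rewrite laguerre_pairing_scal, laguerre_pairing_kummer_poly; fold rho; ring.
  - intros a _; apply poly_growth_mult; [apply poly_growth_const | apply poly_growth_kummer_poly].
Qed.

Lemma laguerre_pairing_pow_S (m n : nat) :
  (2 * r - 1 <= n)%nat ->
  let rho := (-1) ^ r * lam in
  let Q p := laguerre_pairing b lam r i (fun x => x ^ m * meixner_coef b rho r p x) in
  laguerre_pairing b lam r i (fun x => x ^ S m * meixner_coef b rho r n x) =
  INR (S n) * (INR n + b) * Q (S n) - (INR n + b) * Q n + INR r * rho * Q (n - r)%nat
  + INR r * rho * (INR r - (2 * INR n + 1 + b)) * Q (S n - r)%nat
  + (INR r * rho) ^ 2 * Q (n - (2 * r - 1))%nat.
Proof.
  intros Hn rho Q; unfold Q.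
  assert (Hg : forall p, poly_growth (fun k => INR k ^ m * meixner_coef b rho r p (INR k)))
    by (intros p; apply poly_growth_mult; [apply poly_growth_pow | apply poly_growth_meixner_coef]).
  assert (Hgs : forall c p, poly_growth (fun k => c * (INR k ^ m * meixner_coef b rho r p (INR k))))
    by (intros c p; apply poly_growth_mult; [apply poly_growth_const | apply Hg]).
  unfold Rminus at 1; rewrite Ropp_mult_distr_l.
  rewrite <- !laguerre_pairing_scal, <- !laguerre_pairing_plus;
    repeat (apply poly_growth_plus || apply Hgs).
  apply laguerre_pairing_ext; intros x.
  transitivity (x ^ m * (x * meixner_coef b rho r n x)); [simpl; ring|].
  rewrite meixner_recurrence by assumption; unfold shifted.
  destruct (Nat.leb_spec r n); [|lia].
  destruct (Nat.leb_spec r (S n)); [|lia].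
  destruct (Nat.leb_spec (2 * r) (S n)); [|lia].
  replace (S n - 2 * r)%nat with (n - (2 * r - 1))%nat by lia; ring.
Qed.

(** Multiplication by x lowers the index by at most d = 2r - 1. At n = (m+1) d + i the induction
    hypothesis removes all terms except those of index n - d. *)
Lemma laguerre_pairing_pow_meixner (m : nat) :
  1 < lam ->
  let rho := (-1) ^ r * lam in
  (forall n, (m * (2 * r - 1) + i + 1 <= n)%nat ->
     laguerre_pairing b lam r i (fun x => x ^ m * meixner_coef b rho r n x) = 0) /\
  laguerre_pairing b lam r i
    (fun x => x ^ m * meixner_coef b rho r (m * (2 * r - 1) + i) x) <> 0.
Proof.
  intros Hlam1 rho; induction m as [|m [IH0 IH1]].
  - assert (H : forall n, laguerre_pairing b lam r i (fun x => x ^ 0 * meixner_coef b rho r n x)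
        = laguerre_pairing b lam r i (meixner_coef b rho r n))
      by (intros n; apply laguerre_pairing_ext; intros x; simpl; ring).
    split.
    + intros n Hn; rewrite H.
      replace n with ((n - i) + i)%nat by lia; unfold rho; rewrite laguerre_pairing_meixner.
      destruct (Nat.eqb_spec (n - i) 0); [lia | ring].
    + rewrite H; simpl Nat.mul; unfold rho; rewrite laguerre_pairing_meixner; simpl Nat.eqb.
      assert (Hpos : 0 < poch_series b lam r 0 0).
      { unfold poch_series; erewrite Series_ext;
          [exact (laguerre_series_pos b lam r Hb Hlam Hr) | intros k; simpl; ring]. }
      apply Rmult_integral_contrapositive; split; [|lra].
      apply Rmult_integral_contrapositive; split; [lra | apply pow_nonzero; lra].
  - assert (HrR : 1 <= INR r) by (apply (le_INR 1); exact Hr).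
    assert (Hrho : rho <> 0)
      by (apply Rmult_integral_contrapositive; split; [apply pow_nonzero; lra | lra]).
    rewrite Nat.mul_succ_l; set (md := (m * (2 * r - 1))%nat) in *; split.
    + intros n Hn; unfold rho; rewrite laguerre_pairing_pow_S by lia; fold rho.
      rewrite !IH0 by lia; ring.
    + unfold rho; rewrite laguerre_pairing_pow_S by lia; fold rho.
      set (n := (md + (2 * r - 1) + i)%nat).
      assert (Hn : n = (md + (2 * r - 1) + i)%nat) by easy; clearbody n.
      rewrite (IH0 (S n)), (IH0 n), (IH0 (S n - r)%nat) by lia.
      replace (n - (2 * r - 1))%nat with (md + i)%nat by lia.
      set (kap := laguerre_pairing _ _ _ _ _) in IH1 |- *.
      (* For r = 1 the indices n - r and n - (2r - 1) coincide and the coefficients add up to rho +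
         rho^2 = lam (lam - 1), nonzero because lam > 1, that is, because c > 0. *)
      destruct (Nat.eq_dec r 1) as [Hr1|Hr1].
      * replace (n - r)%nat with (md + i)%nat by lia.
        fold kap.
        replace (INR r) with 1 by (rewrite Hr1; easy).
        assert (Hrho1 : rho = - lam) by (unfold rho; rewrite Hr1; simpl; ring).
        rewrite Hrho1.
        match goal with |- ?X <> 0 => replace X with (lam * (lam - 1) * kap) by ring end.
        apply Rmult_integral_contrapositive; split; [|exact IH1].
        apply Rmult_integral_contrapositive; split; lra.
      * rewrite (IH0 (n - r)%nat) by lia.
        match goal with |- ?X <> 0 => replace X with ((INR r * rho) ^ 2 * kap) by ring end.
        apply Rmult_integral_contrapositive; split; [|exact IH1].
        apply pow_nonzero, Rmult_integral_contrapositive; split; [lra | exact Hrho].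
Qed.

(** A power x^k with k < m satisfies k d + i + 1 <= n, where d = 2r - 1, and is annihilated; only
    the leading coefficient counts. *)
Lemma laguerre_pairing_poly_meixner (f : R -> R) (a : nat -> R) (m n : nat) :
  let rho := (-1) ^ r * lam in
  1 < lam -> (forall x, f x = sum_f_R0 (fun k => a k * x ^ k) m) ->
  (m * (2 * r - 1) + i <= n)%nat ->
  laguerre_pairing b lam r i (fun x => f x * meixner_coef b rho r n x) =
  a m * laguerre_pairing b lam r i (fun x => x ^ m * meixner_coef b rho r n x).
Proof.
  intros rho Hlam1 Hf Hn.
  rewrite (laguerre_pairing_ext _
    (fun x => sum_f_R0 (fun k => a k * (x ^ k * meixner_coef b rho r n x)) m)).
  - rewrite (laguerre_pairing_sum (fun k x => a k * (x ^ k * meixner_coef b rho r n x))).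
    + assert (Hz : forall k, (k < m)%nat -> laguerre_pairing b lam r i
        (fun x => a k * (x ^ k * meixner_coef b rho r n x)) = 0).
      { intros k Hk; rewrite laguerre_pairing_scal.
        unfold rho; rewrite (proj1 (laguerre_pairing_pow_meixner k Hlam1)) by nia; ring. }
      destruct m as [|m]; [simpl sum_f_R0; now rewrite laguerre_pairing_scal|].
      rewrite tech5, (sum_eq _ (fun _ => 0)), sum_cte, laguerre_pairing_scal
        by (intros; apply Hz; lia); ring.
    + intros k _; apply poly_growth_mult; [apply poly_growth_const|].
      apply poly_growth_mult; [apply poly_growth_pow | apply poly_growth_meixner_coef].
  - intros x; rewrite Hf, Rmult_comm, scal_sum; apply sum_eq; intros; ring.
Qed.

End Pairing.

(** * Degrees of the polynomials *)

Lemma is_poly_deg_mult_linear (f : R -> R) (n : nat) (s t : R) :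
  s <> 0 -> is_poly_deg f n -> is_poly_deg (fun x => (s * x + t) * f x) (S n).
Proof.
  intros Hs (a & Han & Hf).
  exists (fun k => s * (match k with O => 0 | S j => a j end) + t * (if Nat.leb k n then a k else 0)).
  split.
  - destruct (Nat.leb_spec (S n) n); [lia|].
    rewrite Rmult_0_r, Rplus_0_r; apply Rmult_integral_contrapositive; now split.
  - intros x; rewrite Hf.
    rewrite (sum_eq
      (fun k => (s * (match k with O => 0 | S j => a j end)
                 + t * (if Nat.leb k n then a k else 0)) * x ^ k)
      (fun k => s * (match k with O => 0 | S j => a j end) * x ^ k
                                + t * (if Nat.leb k n then a k else 0) * x ^ k)) by (intros; ring).
    rewrite plus_sum, Rmult_plus_distr_r; f_equal.
    + rewrite sum_f_R0_shift, Rmult_0_r, Rmult_0_l, Rplus_0_l, scal_sum.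
      apply sum_eq; intros k _; simpl pow; ring.
    + rewrite (sum_f_R0_extend _ n (S n)), scal_sum.
      * apply sum_eq; intros k Hk; destruct (Nat.leb_spec k n); [ring | lia].
      * lia.
      * intros k Hk; destruct (Nat.leb_spec k n); [lia | ring].
Qed.

Lemma is_poly_deg_ext (f g : R -> R) (n : nat) :
  (forall x, f x = g x) -> is_poly_deg f n -> is_poly_deg g n.
Proof. intros H (a & Ha & Hf); exists a; split; [easy | intros x; now rewrite <- H]. Qed.

Lemma is_poly_deg_scal (f : R -> R) (n : nat) (s : R) :
  s <> 0 -> is_poly_deg f n -> is_poly_deg (fun x => s * f x) n.
Proof.
  intros Hs (a & Ha & Hf); exists (fun k => s * a k); split.
  - apply Rmult_integral_contrapositive; now split.
  - intros x; rewrite Hf, scal_sum; apply sum_eq; intros; ring.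
Qed.

Lemma is_poly_deg_plus_lower (f g : R -> R) (n m : nat) (s : R) :
  (m < n)%nat -> is_poly_deg f n -> is_poly_deg g m -> is_poly_deg (fun x => f x + s * g x) n.
Proof.
  intros Hmn (a & Ha & Hf) (a' & _ & Hg).
  exists (fun k => a k + s * (if Nat.leb k m then a' k else 0)); split.
  - destruct (Nat.leb_spec n m); [lia|]; now rewrite Rmult_0_r, Rplus_0_r.
  - intros x; rewrite Hf, Hg.
    rewrite (sum_eq (fun k => (a k + s * (if Nat.leb k m then a' k else 0)) * x ^ k)
      (fun k => a k * x ^ k + s * (if Nat.leb k m then a' k else 0) * x ^ k)) by (intros; ring).
    rewrite plus_sum; f_equal.
    rewrite (sum_f_R0_extend _ m n), scal_sum.
    + apply sum_eq; intros k Hk; destruct (Nat.leb_spec k m); [ring | lia].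
    + lia.
    + intros k Hk; destruct (Nat.leb_spec k m); [lia | ring].
Qed.

Lemma is_poly_deg_kummer_poly (b : R) (n : nat) :
  0 < b -> is_poly_deg (fun x => kummer_poly b x n) n.
Proof.
  intros Hb; induction n as [|n IH].
  - exists (fun _ => 1); split; [lra|]; intros x; unfold kummer_poly; simpl; field.
  - pose proof (pos_INR n) as Hn.
    set (q := / ((b + INR n) * (INR n + 1))).
    assert (Hq : 0 < q) by (apply Rinv_0_lt_compat, Rmult_lt_0_compat; lra).
    eapply is_poly_deg_ext; [|apply (is_poly_deg_mult_linear _ n q (q * (b + INR n)) ltac:(lra) IH)].
    intros x; unfold kummer_poly, q; rewrite fact_simpl, mult_INR, S_INR; simpl poch.
    pose proof (poch_pos b n Hb); pose proof (INR_fact_lt_0 n); field; lra.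
Qed.

(** Only the term a = 0, with coefficient 1, reaches degree n. *)
Lemma is_poly_deg_meixner_coef (b rho : R) (r n : nat) :
  0 < b -> (1 <= r)%nat -> is_poly_deg (meixner_coef b rho r n) n.
Proof.
  intros Hb Hr.
  assert (H : forall N, (N <= n)%nat -> is_poly_deg
    (fun x => sum_f_R0 (fun a => exp_pow_coef rho r a * kummer_poly b x (n - a)) N) n);
    [|now apply H].
  induction N as [|N IH]; intros HN; cbn [sum_f_R0].
  - rewrite exp_pow_coef_0, Nat.sub_0_r by exact Hr.
    apply is_poly_deg_scal; [lra | now apply is_poly_deg_kummer_poly].
  - apply (is_poly_deg_plus_lower _ (fun x => kummer_poly b x (n - S N)) n (n - S N));
      [lia | apply IH; lia | now apply is_poly_deg_kummer_poly].
Qed.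

Theorem mainTheorem1 (r : nat) (beta c : R) (M : nat -> R -> R) :
  (1 <= r)%nat -> 0 < beta -> 0 < c < 1 ->
  (* M_n(x; beta, c, d) are defined by their exponential generating function *)
  (forall x z : R,
     is_series (fun n => M n x * z ^ n / INR (fact n))
       (exp (z + (-1) ^ r / (1 - c) * z ^ r) * pFq (- x :: nil) (beta :: nil) (- z))) ->
  (* the functionals L_i are well defined on polynomials (the series converge) *)
  (forall i f, (i < 2 * r - 1)%nat -> is_poly f -> ex_series (L_term r beta c i f)) /\
  d_orthogonal (2 * r - 1) M (L_fun r beta c).
Proof.
  intros Hr Hb Hc HM.
  set (lam := / (1 - c)).
  assert (Hlam1 : 1 < lam) by (unfold lam; rewrite <- Rinv_1 at 1; apply Rinv_lt_contravar; lra).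
  assert (Hlam : 1 <= lam) by lra.
  set (rho := (-1) ^ r * lam).
  assert (HMn : forall n x, M n x = INR (fact n) * meixner_coef beta rho r n x).
  { intros n x; apply (meixner_coef_of_gf beta rho r x (fun n => M n x)); try assumption.
    apply HM. }
  set (K := fun i => (-1) ^ i / (Gamma beta * sqrt (INR (fact i) * poch beta i))).
  assert (HK : forall i, K i <> 0).
  { intros i; apply Rmult_integral_contrapositive; split; [apply pow_nonzero; lra|].
    apply Rinv_neq_0_compat, Rgt_not_eq, Rmult_lt_0_compat; [now apply Gamma_pos|].
    apply sqrt_lt_R0, Rmult_lt_0_compat; [apply INR_fact_lt_0 | now apply poch_pos]. }
  assert (HL : forall i f k, L_term r beta c i f k =
    K i * (f (INR k) * laguerre_functional beta (moment beta lam r) k i)).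
  { intros i f k; unfold L_term; rewrite w_weight_laguerre by assumption; unfold K, lam; ring. }
  assert (HLf : forall i f, L_fun r beta c i f = K i * laguerre_pairing beta lam r i f).
  { intros i f; unfold L_fun; rewrite (Series_ext _ _ (HL i f)); apply Series_scal_l. }
  split; [|split].
  - intros i f _ Hf.
    apply (ex_series_ext (fun k => scal (K i) (f (INR k) * laguerre_functional beta (moment beta lam r) k i)));
      [intros k; symmetry; apply HL|].
    apply (ex_series_scal_l (K := R_AbsRing) (V := R_NormedModule)).
    now apply ex_laguerre_pairing, poly_growth_is_poly.
  - intros n; eapply is_poly_deg_ext; [intros x; symmetry; apply HMn|].
    apply is_poly_deg_scal; [apply INR_fact_neq_0 | now apply is_poly_deg_meixner_coef].
  - intros i _.
    (* Once n >= m d + i, the factor M_m can be replaced by a nonzero multiple of x^m, so both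
       orthogonality conditions become statements about powers. *)
    assert (HP : forall m n, (m * (2 * r - 1) + i <= n)%nat -> exists a, a <> 0 /\
      L_fun r beta c i (fun x => M m x * M n x) =
      a * laguerre_pairing beta lam r i (fun x => x ^ m * meixner_coef beta rho r n x)).
    { intros m n Hn.
      destruct (is_poly_deg_meixner_coef beta rho r m Hb Hr) as (a & Ha & Hpoly).
      exists (K i * (INR (fact m) * INR (fact n) * a m)); split.
      - apply Rmult_integral_contrapositive; split; [apply HK|].
        apply Rmult_integral_contrapositive; split; [|exact Ha].
        apply Rmult_integral_contrapositive; split; apply INR_fact_neq_0.
      - rewrite HLf, (laguerre_pairing_ext _ _ _ _ _
          (fun x => INR (fact m) * INR (fact n) * (meixner_coef beta rho r m x * meixner_coef beta rho r n x)))
          by (intros x; rewrite !HMn; ring).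
        rewrite laguerre_pairing_scal.
        unfold rho at 2; rewrite (laguerre_pairing_poly_meixner _ _ _ _ Hb Hlam Hr _ a m n Hlam1 Hpoly Hn).
        fold rho; ring. }
    split.
    + intros m n Hn; destruct (HP m n) as (a & _ & ->); [lia|].
      unfold rho; rewrite (proj1 (laguerre_pairing_pow_meixner _ _ _ _ Hb Hlam Hr m Hlam1)) by exact Hn.
      ring.
    + intros n; destruct (HP n (n * (2 * r - 1) + i)%nat) as (a & Ha & ->); [lia|].
      apply Rmult_integral_contrapositive; split; [exact Ha|].
      apply (proj2 (laguerre_pairing_pow_meixner _ _ _ _ Hb Hlam Hr n Hlam1)).
Qed.
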